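(* There is a constant $c>0$ such that for every integer $n\ge2$ and every pair of vertices $s,t\in V$, the expected number of forwards performed by the greedy routing algorithm on the OSW graph $G_n$ from source $s$ to target $t$ is at most $c\log^2 n$; i.e., it is $\mathcal{O}(\log^2 n)$. The expectation is over the random long-range edges of $G_n$.
   Context: For an integer $n\ge1$, the $n$-octahedral graph $G'_n=(V,E')$ is the undirected graph with vertex set $V=\{u\in\mathbb{Z}^3:|u_1|+|u_2|+|u_3|=n\}$ and edge set $E'=\{\{v,w\}\subset V: v\neq w,\ |v_i-w_i|\le 1 \text{ for all } i=1,2,3\}$. For $u,v\in V$, $d_{uv}$ denotes the shortest-path distance between $u$ and $v$ in $G'_n$, and $Z_u=\left(\sum_{w\in V\setminus\{u\}} d_{uw}^{-2}\right)^{-1}$. The octahedral small world (OSW) random graph $G_n=(V,E)$ is the directed graph obtained as follows: for every $\{u,v\}\in E'$ both $(u,v)$ and $(v,u)$ belong to $E$; in addition, each vertex $u\in V$, independently of all other vertices, chooses one vertex $v\in V\setminus\{u\}$ with probability $Z_u\,d_{uv}^{-2}$, and the directed (long-range) edge $(u,v)$ is added to $E$. Greedy routing algorithm: a message with target $t$ starts at the source $s$; while the current vertex $u$ is not $t$, $u$ forwards the message to an out-neighbor $v$ of $u$ in $G_n$ maximizing $\frac{v\cdot t}{|v|\,|t|}$ (i.e., minimizing the angle between the vectors $v$ and $t$ in $\mathbb{R}^3$), where $v\cdot t=\sum_{i=1}^3 v_it_i$ and $|w|=(\sum_{i=1}^3 w_i^2)^{1/2}$. Each such step is one forward. *)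

(* Defs.v *)
From HB Require Import structures.
From mathcomp Require Import all_boot all_order all_algebra all_field.
Set Implicit Arguments. Unset Strict Implicit. Unset Printing Implicit Defensive.
Import Order.TTheory GRing.Theory Num.Theory.
Local Open Scope ring_scope.

(* Integer coordinates in [-n, n] are encoded by 'I_(2n+1) via i |-> i - n. *)
Definition crd (n : nat) (i : 'I_(2 * n + 1)) : int := (i : nat)%:Z - n%:Z.

Definition Box (n : nat) : finType :=
  ('I_(2 * n + 1) * 'I_(2 * n + 1) * 'I_(2 * n + 1))%type.

Definition x1 n (x : Box n) : int := crd x.1.1.
Definition x2 n (x : Box n) : int := crd x.1.2.
Definition x3 n (x : Box n) : int := crd x.2.

Definition onsphere n (x : Box n) : bool :=
  (absz (x1 x) + absz (x2 x) + absz (x3 x) == n)%N.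

Definition V (n : nat) : finType := {x : Box n | onsphere x}.

Definition c1 n (v : V n) : int := x1 (val v).
Definition c2 n (v : V n) : int := x2 (val v).
Definition c3 n (v : V n) : int := x3 (val v).

Definition adj n (v w : V n) : bool :=
  [&& v != w, `|c1 v - c1 w| <= 1, `|c2 v - c2 w| <= 1 & `|c3 v - c3 w| <= 1].

Fixpoint ball n (k : nat) (u : V n) : {set V n} :=
  match k with
  | 0 => [set u]
  | k.+1 => ball k u :|: [set w | [exists v in ball k u, adj v w]]
  end.

(* Shortest-path distance d_{uv} in G'_n: least k with v in ball k u.
   (Any reachable vertex is within #|V n| - 1 steps, and G'_n is connected.) *)
Definition dist n (u v : V n) : nat :=
  \big[minn/#|V n|]_(k < #|V n| | v \in ball k u) (k : nat).

Definition Zc n (u : V n) : algC :=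
  (\sum_(w : V n | w != u) ((dist u w ^ 2)%:R)^-1)^-1.

Definition lrprob n (u v : V n) : algC :=
  if v == u then 0 else Zc u / (dist u v ^ 2)%:R.

(* A configuration of long-range edges: L u is the contact of u.
   Its probability (independent choices): *)
Definition cfgprob n (L : {ffun V n -> V n}) : algC :=
  \prod_(u : V n) lrprob u (L u).

Definition outnb n (L : {ffun V n -> V n}) (u : V n) : {set V n} :=
  L u |: [set w | adj u w].

Definition dot n (v w : V n) : int := c1 v * c1 w + c2 v * c2 w + c3 v * c3 w.

Definition cosang n (v t : V n) : algC :=
  (dot v t)%:~R / (sqrtC (dot v v)%:~R * sqrtC (dot t t)%:~R).

Definition greedy_set n (L : {ffun V n -> V n}) (t u : V n) : {set V n} :=
  [set v in outnb L u | [forall w in outnb L u, cosang w t <= cosang v t]].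

Definition tiebreak n (tb : V n -> {set V n} -> V n) : Prop :=
  forall (u : V n) (A : {set V n}), A != set0 -> tb u A \in A.

Definition gstep n (tb : V n -> {set V n} -> V n) (L : {ffun V n -> V n})
  (t u : V n) : V n :=
  if u == t then t else tb u (greedy_set L t u).

(* The message reaches t (equivalently, within #|V n| forwards, by finiteness) *)
Definition reaches n tb (L : {ffun V n -> V n}) (s t : V n) : Prop :=
  exists k : nat, iter k (gstep tb L t) s = t.

(* Number of forwards until t is reached (valid when t is reached: the walk
   stays at t afterwards, and the hitting time is < #|V n|). *)
Definition forwards n tb (L : {ffun V n -> V n}) (s t : V n) : nat :=
  \sum_(k < #|V n|) (iter k (gstep tb L t) s != t).

Definition expected_forwards n tb (s t : V n) : algC :=
  \sum_(L : {ffun V n -> V n}) cfgprob L * (forwards tb L s t)%:R.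

(* Main.v *)
(** For u <> t, project a fan of lattice triangles u, v, w around u radially:
    t lies in the wedge of one of them, so n t = A u + B v + C w with B, C >= 0,
    and A <= 0 because t is a lattice point outside the open triangle.  The
    spherical triangle has an angle of at most 90 degrees at u, which forces v
    or w to be strictly closer to t in angle than u.  Hence greedy routing
    strictly increases the cosine, never visits a vertex twice, and the contact
    of each visited vertex is independent of the past.

    Put rho(u) = 1 - cos(u, t).  Then n^2 rho(u) is comparable to the squared L1
    distance D^2 from u to t, and graph, L1 and L-infinity distances are
    comparable.  The normalising sum is O(log n), by summing over dyadic
    L-infinity shells, while about D^2 vertices v with 4 rho(v) <= rho(u) lie
    within distance O(D) of u; so the contact of u divides rho by 4 with
    probability at least a constant over log n.  The phase, the number of powers
    of 4 below 24 n^2 rho, is O(log n) and never increases, and telescoping its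
    expected decrease bounds the expected number of forwards by O(log n) times
    the inverse of that probability. *)
Require Import Defs.
From HB Require Import structures.
From mathcomp Require Import all_boot all_order all_algebra all_field.
From mathcomp Require Import zify ring lra.
Import Order.TTheory GRing.Theory Num.Theory.
Local Open Scope ring_scope.

(** * Greedy progress *)

(** [a], [b], [c] are the coefficients of a target vector in three unit vectors with pairwise
    cosines [p], [q], [r]; the expressions compared are its dot products with these vectors. By the
    spherical law of cosines, [p * q <= r] says that the angle at the first vector is at most 90
    degrees. *)
Lemma wedge_closer (R : realFieldType) (a b c p q r : R) :
  a <= 0 -> 0 <= b -> 0 <= c -> [|| a < 0, 0 < b | 0 < c] ->
  p < 1 -> q < 1 -> p * q <= r ->
  a + b * p + c * q < a * p + b + c * r \/
  a + b * p + c * q < a * q + b * r + c.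
Proof.
move=> a0 b0 c0 nz p1 q1 pqr.
have bpq : b * (p * q) <= b * r by rewrite ler_wpM2l.
have cpq : c * (p * q) <= c * r by rewrite ler_wpM2l.
have bp : b * p <= b by rewrite ler_piMr // ltW.
have cq : c * q <= c by rewrite ler_piMr // ltW.
(* The vector with the larger coefficient wins: for [c <= b] the gain is at least
   [(1 - p) * (b - a - c * q)], and symmetrically otherwise. *)
case: (lerP c b) => cb.
  left.
  have : a - b + c * q < 0.
    have [c_gt0|c_le0] := ltrP 0 c.
      have : c * q < c by rewrite gtr_pMr.
      lra.
    have c_0 : c = 0 by lra.
    by rewrite c_0; case/or3P: nz; lra.
  move=> neg.
  have : (1 - p) * (a - b + c * q) < 0 by rewrite pmulr_rlt0 ?subr_gt0.
  lra.
right.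
have : a - c + b * p < 0 by lra.
move=> neg.
have : (1 - q) * (a - c + b * p) < 0 by rewrite pmulr_rlt0 ?subr_gt0.
lra.
Qed.

(** * Dot products and cosines of integer vectors *)

Fact rt_subproof (m : int) : sqrtC `|m|%:~R \is @Num.real algC.
Proof. by rewrite ger0_real // sqrtC_ge0 ler0z. Qed.

(* The absolute value only serves to make the square root real for every [m]. *)
Definition rt (m : int) : algR := in_algR (rt_subproof m).

Lemma rt_ge0 m : 0 <= rt m.
Proof. by rewrite -[_ <= _]/((0 : algC) <= sqrtC _) sqrtC_ge0 ler0z. Qed.

Lemma rt_sqr m : 0 <= m -> rt m * rt m = m%:~R.
Proof.
move=> m0; apply: val_inj.
by rewrite /= -expr2 sqrtCK (ger0_norm m0) (rmorph_int algRval).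
Qed.

Lemma rt_gt0 m : 0 < m -> 0 < rt m.
Proof.
move=> m0; rewrite lt_neqAle rt_ge0 andbT; apply/eqP => e.
have := rt_sqr m (ltW m0); rewrite -e mul0r => /esym/eqP.
by rewrite intr_eq0 => /eqP; lia.
Qed.

Definition dot3 (u1 u2 u3 v1 v2 v3 : int) : int := u1 * v1 + u2 * v2 + u3 * v3.

(** The cosine multiplied by the norm of [t]: comparisons are made for a fixed [t], so this factor
    is left out. *)
Definition cosn (u1 u2 u3 t1 t2 t3 : int) : algR :=
  (dot3 u1 u2 u3 t1 t2 t3)%:~R / rt (dot3 u1 u2 u3 u1 u2 u3).

Lemma lt_of_sqr_lt (R : realFieldType) (d z : R) : 0 <= z -> d * d < z * z -> d < z.
Proof.
move=> z0 h; rewrite ltNge; apply/negP => zd.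
by move: h; rewrite ltNge => /negP; apply; rewrite ler_pM.
Qed.

(** This is [wedge_closer] for the normalised vectors: strict Cauchy-Schwarz gives [p < 1] and
    [q < 1], and the last inequality is [p * q <= r] cleared of denominators. The factor [n] keeps
    the coefficients integral. *)
Lemma wedge_vec (u1 u2 u3 v1 v2 v3 w1 w2 w3 t1 t2 t3 A B C n : int) :
  let uu := dot3 u1 u2 u3 u1 u2 u3 in
  let vv := dot3 v1 v2 v3 v1 v2 v3 in
  let ww := dot3 w1 w2 w3 w1 w2 w3 in
  let uv := dot3 u1 u2 u3 v1 v2 v3 in
  let uw := dot3 u1 u2 u3 w1 w2 w3 in
  let vw := dot3 v1 v2 v3 w1 w2 w3 in
  0 < uu -> 0 < vv -> 0 < ww -> 0 < n ->
  n * t1 = A * u1 + B * v1 + C * w1 ->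
  n * t2 = A * u2 + B * v2 + C * w2 ->
  n * t3 = A * u3 + B * v3 + C * w3 ->
  A <= 0 -> 0 <= B -> 0 <= C -> [|| A < 0, 0 < B | 0 < C] ->
  uv * uv < uu * vv -> uw * uw < uu * ww -> uv * uw <= uu * vw ->
  cosn u1 u2 u3 t1 t2 t3 < cosn v1 v2 v3 t1 t2 t3 \/
  cosn u1 u2 u3 t1 t2 t3 < cosn w1 w2 w3 t1 t2 t3.
Proof.
move=> uu vv ww uv uw vw uu0 vv0 ww0 n0 e1 e2 e3 A0 B0 C0 nz cuv cuw cvw.
have x0 := rt_gt0 _ uu0; have y0 := rt_gt0 _ vv0; have z0 := rt_gt0 _ ww0.
have xx := rt_sqr _ (ltW uu0); have yy := rt_sqr _ (ltW vv0).
have zz := rt_sqr _ (ltW ww0).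
pose x := rt uu; pose y := rt vv; pose z := rt ww.
rewrite -/x -/y -/z in x0 y0 z0 xx yy zz.
have xn : x != 0 by rewrite gt_eqF.
have yn : y != 0 by rewrite gt_eqF.
have zn : z != 0 by rewrite gt_eqF.
have Rn0 : 0 < n%:~R :> algR by rewrite ltr0z.
pose a := A%:~R * x; pose b := B%:~R * y; pose c := C%:~R * z.
pose p := uv%:~R / (x * y); pose q := uw%:~R / (x * z); pose r := vw%:~R / (y * z).
have := @wedge_closer algR a b c p q r.
have I : forall k : int, 0 < k -> 0 < k%:~R :> algR by move=> k; rewrite ltr0z.
have -> : a <= 0 by rewrite /a pmulr_lle0 // lerz0.
have -> : 0 <= b by rewrite mulr_ge0 ?ler0z // ltW.
have -> : 0 <= c by rewrite mulr_ge0 ?ler0z // ltW.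
have -> : [|| a < 0, 0 < b | 0 < c].
  by rewrite /a /b /c pmulr_llt0 // !pmulr_lgt0 // ltrz0 !ltr0z.
have -> : p < 1.
  rewrite /p ltr_pdivrMr ?mulr_gt0 // mul1r; apply: lt_of_sqr_lt.
    by rewrite ltW ?mulr_gt0.
  by rewrite mulrACA xx yy -!intrM ltr_int.
have -> : q < 1.
  rewrite /q ltr_pdivrMr ?mulr_gt0 // mul1r; apply: lt_of_sqr_lt.
    by rewrite ltW ?mulr_gt0.
  by rewrite mulrACA xx zz -!intrM ltr_int.
have -> : p * q <= r.
  have -> : p * q = (uv * uw)%:~R / (uu%:~R * (y * z)).
    by rewrite /p /q -xx intrM; field; rewrite xn yn zn.
  rewrite ler_pdivrMr ?mulr_gt0 ?ltr0z // /r mulrCA divfK ?mulf_neq0 //.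
  by rewrite -intrM ler_int.
move/(_ isT isT isT isT isT isT isT).
have E k1 k2 k3 : n%:~R * (dot3 k1 k2 k3 t1 t2 t3)%:~R =
  A%:~R * (dot3 u1 u2 u3 k1 k2 k3)%:~R + B%:~R * (dot3 v1 v2 v3 k1 k2 k3)%:~R +
  C%:~R * (dot3 w1 w2 w3 k1 k2 k3)%:~R :> algR.
  rewrite -!intrM -!intrD; congr (_%:~R); rewrite /dot3.
  have -> : n * (k1 * t1 + k2 * t2 + k3 * t3) =
            k1 * (n * t1) + k2 * (n * t2) + k3 * (n * t3) by ring.
  by rewrite e1 e2 e3; ring.
have eu : n%:~R * cosn u1 u2 u3 t1 t2 t3 = a + b * p + c * q.
  rewrite /cosn mulrA E -/uu -/x /a /b /c /p /q.
  have -> : dot3 v1 v2 v3 u1 u2 u3 = uv by rewrite /uv /dot3; ring.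
  have -> : dot3 w1 w2 w3 u1 u2 u3 = uw by rewrite /uw /dot3; ring.
  by rewrite -xx; field; rewrite xn yn zn.
have ev : n%:~R * cosn v1 v2 v3 t1 t2 t3 = a * p + b + c * r.
  rewrite /cosn mulrA E -/vv -/y -/uv /a /b /c /p /r.
  have -> : dot3 w1 w2 w3 v1 v2 v3 = vw by rewrite /vw /dot3; ring.
  by rewrite -yy; field; rewrite xn yn zn.
have ew : n%:~R * cosn w1 w2 w3 t1 t2 t3 = a * q + b * r + c.
  rewrite /cosn mulrA E -/ww -/z -/uw -/vw /a /b /c /q /r.
  by rewrite -zz; field; rewrite xn yn zn.
by rewrite -eu -ev -ew !ltr_pM2l.
Qed.

(** * Existence of a lattice neighbour closer in angle *)

Definition nearer (u1 u2 u3 t1 t2 t3 : int) : Prop :=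
  exists w1 w2 w3 : int,
  [/\ `|u1 - w1| <= 1, `|u2 - w2| <= 1, `|u3 - w3| <= 1,
      `|w1| + `|w2| + `|w3| = `|u1| + `|u2| + `|u3| &
      cosn u1 u2 u3 t1 t2 t3 < cosn w1 w2 w3 t1 t2 t3].

Lemma nearer_swap12 u1 u2 u3 t1 t2 t3 :
  nearer u2 u1 u3 t2 t1 t3 -> nearer u1 u2 u3 t1 t2 t3.
Proof.
have E : forall x1 x2 x3 y1 y2 y3, dot3 x1 x2 x3 y1 y2 y3 = dot3 x2 x1 x3 y2 y1 y3.
  by move=> *; rewrite /dot3; ring.
move=> [w1 [w2 [w3 [h1 h2 h3 h4 h5]]]]; exists w2, w1, w3; split=> //; first lia.
by move: h5; rewrite /cosn; rewrite !(E u2 u1 u3) !(E w1 w2 w3).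
Qed.

Lemma nearer_swap23 u1 u2 u3 t1 t2 t3 :
  nearer u1 u3 u2 t1 t3 t2 -> nearer u1 u2 u3 t1 t2 t3.
Proof.
have E : forall x1 x2 x3 y1 y2 y3, dot3 x1 x2 x3 y1 y2 y3 = dot3 x1 x3 x2 y1 y3 y2.
  by move=> *; rewrite /dot3; ring.
move=> [w1 [w2 [w3 [h1 h2 h3 h4 h5]]]]; exists w1, w3, w2; split=> //; first lia.
by move: h5; rewrite /cosn; rewrite !(E u1 u3 u2) !(E w1 w2 w3).
Qed.

Lemma sign_mul_norm (s x : int) : s * s = 1 -> `|s * x| = `|x|.
Proof.
move/(congr1 (@Num.norm _ _)); rewrite normrM normr1 => e.
by rewrite normrM (_ : `|s| = 1) ?mul1r //; nia.
Qed.

Lemma sign_mul_cancel (s x y : int) : s * s = 1 -> s * x * (s * y) = x * y.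
Proof. by rewrite mulrACA => ->; rewrite mul1r. Qed.

(** Sign changes preserve dot products and absolute values; they allow a reduction to [u] in the
    nonnegative octant. *)
Lemma nearer_sign (s1 s2 s3 u1 u2 u3 t1 t2 t3 : int) :
  s1 * s1 = 1 -> s2 * s2 = 1 -> s3 * s3 = 1 ->
  nearer (s1 * u1) (s2 * u2) (s3 * u3) (s1 * t1) (s2 * t2) (s3 * t3) ->
  nearer u1 u2 u3 t1 t2 t3.
Proof.
move=> e1 e2 e3 [w1 [w2 [w3 [h1 h2 h3 h4 h5]]]].
have D (s x y : int) : s * s = 1 -> `|x - s * y| = `|s * x - y|.
  by move=> e; rewrite -(sign_mul_norm s (x - _) e) mulrBr mulrA e mul1r.
exists (s1 * w1), (s2 * w2), (s3 * w3).
split; rewrite ?D // ?sign_mul_norm //; first by move: h4; rewrite !sign_mul_norm.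
move: h5; rewrite /cosn /dot3 !sign_mul_cancel //.
by rewrite !(mulrCA w1, mulrCA w2, mulrCA w3) !mulrA.
Qed.

(* If [0 < A] then [t] lies in the cone over the unimodular triangle [u], [v], [w],
   so that [B + C] would be a multiple of [n] smaller than [n]. *)
Lemma wedge_coef_le0 (n u1 u2 u3 v1 v2 v3 w1 w2 w3 t1 t2 t3 A B C : int) :
  0 < n -> 0 <= u1 -> 0 <= u2 -> 0 <= u3 -> 0 <= v1 -> 0 <= v2 -> 0 <= v3 ->
  0 <= w1 -> 0 <= w2 -> 0 <= w3 ->
  u1 + u2 + u3 = n -> `|t1| + `|t2| + `|t3| = n ->
  (t1, t2, t3) <> (u1, u2, u3) ->
  A + B + C = t1 + t2 + t3 -> 0 <= B -> 0 <= C ->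
  n * t1 = A * u1 + B * v1 + C * w1 ->
  n * t2 = A * u2 + B * v2 + C * w2 ->
  n * t3 = A * u3 + B * v3 + C * w3 ->
  (t1 + t2 + t3 = n -> exists d, d <> 0 /\ (B + C = n * d)) ->
  A <= 0.
Proof.
move=> n0 u10 u20 u30 v10 v20 v30 w10 w20 w30 un tn tu As B0 C0 e1 e2 e3 H.
rewrite leNgt; apply/negP => A0.
(* A positive [A] puts [t] in the nonnegative octant, so its coordinates sum to [n]. *)
have T (t x y z : int) : n * t = A * x + B * y + C * z ->
    0 <= x -> 0 <= y -> 0 <= z -> 0 <= t.
  move=> e x0 y0 z0; rewrite -(pmulr_rge0 _ n0) e !addr_ge0 // mulr_ge0 //.
  exact: ltW.
have t10 := T _ _ _ _ e1 u10 v10 w10.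
have t20 := T _ _ _ _ e2 u20 v20 w20.
have t30 := T _ _ _ _ e3 u30 v30 w30.
have s : t1 + t2 + t3 = n by lia.
have [d [dn e]] := H s.
have : n * d < n by lia.
have : 0 <= n * d by lia.
rewrite pmulr_rge0 // gtr_pMr //; lia.
Qed.

Lemma sqr_int_gt0 (x : int) : x != 0 -> 0 < x ^+ 2.
Proof. by move=> x0; rewrite exprn_even_gt0. Qed.

Lemma dot3_cauchy (u1 u2 u3 v1 v2 v3 : int) :
  [|| u1 * v2 - u2 * v1 != 0, u1 * v3 - u3 * v1 != 0 | u2 * v3 - u3 * v2 != 0] ->
  dot3 u1 u2 u3 v1 v2 v3 * dot3 u1 u2 u3 v1 v2 v3 <
  dot3 u1 u2 u3 u1 u2 u3 * dot3 v1 v2 v3 v1 v2 v3.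
Proof.
move=> h; rewrite -subr_gt0.
have -> : dot3 u1 u2 u3 u1 u2 u3 * dot3 v1 v2 v3 v1 v2 v3 -
   dot3 u1 u2 u3 v1 v2 v3 * dot3 u1 u2 u3 v1 v2 v3 =
  (u1 * v2 - u2 * v1) ^+ 2 + (u1 * v3 - u3 * v1) ^+ 2 + (u2 * v3 - u3 * v2) ^+ 2.
  by rewrite /dot3; ring.
have a := sqr_ge0 (u1 * v2 - u2 * v1).
have b := sqr_ge0 (u1 * v3 - u3 * v1).
have c := sqr_ge0 (u2 * v3 - u3 * v2).
by case/or3P: h => /sqr_int_gt0; move: a b c; do 3!move: (_ ^+ 2) => ?; lia.
Qed.

Lemma dot3_gt0 (u1 u2 u3 : int) :
  0 < `|u1| + `|u2| + `|u3| -> 0 < dot3 u1 u2 u3 u1 u2 u3.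
Proof.
move=> h; rewrite /dot3.
have a := sqr_ge0 u1; have b := sqr_ge0 u2; have c := sqr_ge0 u3.
rewrite -!expr2.
have : [|| u1 != 0, u2 != 0 | u3 != 0] by lia.
by case/or3P => /sqr_int_gt0; move: a b c; do 3!move: (_ ^+ 2) => ?; lia.
Qed.

(** The vector [n t - s u] has coordinate sum zero. With its first two coordinates [B], [C]
    nonnegative it equals [B (e1 - e3) + C (e2 - e3)], so the triangle to use is [u], [u + e1 - e3],
    [u + e2 - e3]. *)
Lemma nearer_neg3 (n u1 u2 u3 t1 t2 t3 : int) :
  0 < n -> 0 <= u1 -> 0 <= u2 -> 1 <= u3 -> u1 + u2 + u3 = n ->
  `|t1| + `|t2| + `|t3| = n -> (t1, t2, t3) <> (u1, u2, u3) ->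
  let s := t1 + t2 + t3 in
  0 <= n * t1 - s * u1 -> 0 <= n * t2 - s * u2 ->
  nearer u1 u2 u3 t1 t2 t3.
Proof.
move=> n0 u10 u20 u30 un tn tu s B0 C0.
pose B := n * t1 - s * u1; pose C := n * t2 - s * u2; pose A := s - B - C.
have e1 : n * t1 = A * u1 + B * (u1 + 1) + C * u1 by rewrite /A /B /C; ring.
have e2 : n * t2 = A * u2 + B * u2 + C * (u2 + 1) by rewrite /A /B /C; ring.
have e3 : n * t3 = A * u3 + B * (u3 - 1) + C * (u3 - 1).
  by rewrite /A /B /C /s -un; ring.
rewrite -/B -/C in B0 C0.
have As : A + B + C = s by rewrite /A; ring.
(* This exhibits [B + C] as a multiple of [n]; the multiple is nonzero because otherwise [B = C = 0]
   and [t = u]. *)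
have BCE : s = n -> B + C = n * (u3 - t3).
  move=> sn; rewrite mulrBr -{1}sn; rewrite /B /C /s -un; ring.
have BE : s = n -> B = n * (t1 - u1) by move=> sn; rewrite /B sn; ring.
have CE : s = n -> C = n * (t2 - u2) by move=> sn; rewrite /C sn; ring.
have nz : [|| A < 0, 0 < B | 0 < C] || (A == 0) && (B == 0) && (C == 0) || (0 < A).
  by move: (A) (B) (C) B0 C0 => a b c; lia.
clearbody A B C.
have A0 : A <= 0.
  apply: (wedge_coef_le0 n u1 u2 u3 (u1 + 1) u2 (u3 - 1) u1 (u2 + 1) (u3 - 1)
            t1 t2 t3 A B C) => //; try by clear -u10 u20 u30; lia.
  move=> sn; exists (u3 - t3); split; last exact: BCE.
  move=> e; apply: tu.
  have [b c] : B = 0 /\ C = 0 by move: (BCE sn); rewrite e mulr0; clear -B0 C0; lia.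
  move: (BE sn) (CE sn); rewrite b c => /esym/eqP + /esym/eqP.
  rewrite !mulf_eq0 => ? ?; congr (_, _, _); clear BCE BE CE e1 e2 e3; lia.
(* Three zero coefficients would give [t = 0]. *)
have {}nz : [|| A < 0, 0 < B | 0 < C].
  case/orP: nz => [/orP[//|/andP[/andP[/eqP a /eqP b] /eqP c]]|]; last by rewrite ltNge A0.
  move: e1 e2 e3; rewrite a b c !mul0r !addr0 => /eqP + /eqP + /eqP.
  rewrite !mulf_eq0; clear -n0 tn; lia.
have := @wedge_vec u1 u2 u3 (u1 + 1) u2 (u3 - 1) u1 (u2 + 1) (u3 - 1) t1 t2 t3 A B C n.
clear -n0 e1 e2 e3 A0 B0 C0 nz u10 u20 u30.
case=> //.
- apply: dot3_gt0; lia.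
- apply: dot3_gt0; lia.
- apply: dot3_gt0; lia.
- apply: dot3_cauchy; apply/or3P/Or32.
  by rewrite (_ : _ - _ = - (u1 + u3)); [clear -u10 u30; lia | ring].
- apply: dot3_cauchy; apply/or3P/Or33.
  by rewrite (_ : _ - _ = - (u2 + u3)); [clear -u20 u30; lia | ring].
(* The angle at [u] is at most 90 degrees: in this octant the difference is a sum of nonnegative
   terms. *)
- rewrite -subr_ge0 /dot3.
  rewrite (_ : _ - _ = (u1 - u2) ^+ 2 + u1 * u2 + u1 * u3 + u2 * u3); last by ring.
  by rewrite !addr_ge0 ?sqr_ge0 ?mulr_ge0 //; lia.
- move=> h; exists (u1 + 1), u2, (u3 - 1); split=> //; clear -u10 u20 u30; lia.
- move=> h; exists u1, (u2 + 1), (u3 - 1); split=> //; clear -u10 u20 u30; lia.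
Qed.

(** For the complementary sign pattern, [n t - s u] is [B (e1 - e2) + C (e1 - e3)], and the triangle
    is [u], [u + e1 - e2], [u + e1 - e3]. *)
Lemma nearer_neg23 (n u1 u2 u3 t1 t2 t3 : int) :
  0 < n -> 0 <= u1 -> 1 <= u2 -> 1 <= u3 -> u1 + u2 + u3 = n ->
  `|t1| + `|t2| + `|t3| = n -> (t1, t2, t3) <> (u1, u2, u3) ->
  let s := t1 + t2 + t3 in
  n * t2 - s * u2 <= 0 -> n * t3 - s * u3 <= 0 ->
  nearer u1 u2 u3 t1 t2 t3.
Proof.
move=> n0 u10 u20 u30 un tn tu s B0 C0.
pose B := s * u2 - n * t2; pose C := s * u3 - n * t3; pose A := s - B - C.
have e1 : n * t1 = A * u1 + B * (u1 + 1) + C * (u1 + 1).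
  by rewrite /A /B /C /s -un; ring.
have e2 : n * t2 = A * u2 + B * (u2 - 1) + C * u2 by rewrite /A /B /C; ring.
have e3 : n * t3 = A * u3 + B * u3 + C * (u3 - 1) by rewrite /A /B /C; ring.
rewrite -opprB -/B oppr_le0 in B0; rewrite -opprB -/C oppr_le0 in C0.
have As : A + B + C = s by rewrite /A; ring.
have BCE : s = n -> B + C = n * (t1 - u1).
  move=> sn; rewrite mulrBr -[in X in _ - X]sn; rewrite /B /C /s -un; ring.
have BE : s = n -> B = n * (u2 - t2) by move=> sn; rewrite /B sn; ring.
have CE : s = n -> C = n * (u3 - t3) by move=> sn; rewrite /C sn; ring.
have nz : [|| A < 0, 0 < B | 0 < C] || (A == 0) && (B == 0) && (C == 0) || (0 < A).
  by move: (A) (B) (C) B0 C0 => a b c; lia.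
clearbody A B C.
have A0 : A <= 0.
  apply: (wedge_coef_le0 n u1 u2 u3 (u1 + 1) (u2 - 1) u3 (u1 + 1) u2 (u3 - 1)
            t1 t2 t3 A B C) => //; try by clear -u10 u20 u30; lia.
  move=> sn; exists (t1 - u1); split; last exact: BCE.
  move=> e; apply: tu.
  have [b c] : B = 0 /\ C = 0 by move: (BCE sn); rewrite e mulr0; clear -B0 C0; lia.
  move: (BE sn) (CE sn); rewrite b c => /esym/eqP + /esym/eqP.
  rewrite !mulf_eq0 => ? ?; congr (_, _, _); clear BCE BE CE e1 e2 e3; lia.
have {}nz : [|| A < 0, 0 < B | 0 < C].
  case/orP: nz => [/orP[//|/andP[/andP[/eqP a /eqP b] /eqP c]]|]; last by rewrite ltNge A0.
  move: e1 e2 e3; rewrite a b c !mul0r !addr0 => /eqP + /eqP + /eqP.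
  rewrite !mulf_eq0; clear -n0 tn; lia.
have := @wedge_vec u1 u2 u3 (u1 + 1) (u2 - 1) u3 (u1 + 1) u2 (u3 - 1) t1 t2 t3 A B C n.
clear -n0 e1 e2 e3 A0 B0 C0 nz u10 u20 u30.
case=> //.
- apply: dot3_gt0; lia.
- apply: dot3_gt0; lia.
- apply: dot3_gt0; lia.
- apply: dot3_cauchy; apply/or3P/Or31.
  by rewrite (_ : _ - _ = - (u1 + u2)); [clear -u10 u20; lia | ring].
- apply: dot3_cauchy; apply/or3P/Or32.
  by rewrite (_ : _ - _ = - (u1 + u3)); [clear -u10 u30; lia | ring].
- rewrite -subr_ge0 /dot3.
  rewrite (_ : _ - _ = (u2 - u3) ^+ 2 + u2 * u3 + u1 * u2 + u1 * u3); last by ring.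
  by rewrite !addr_ge0 ?sqr_ge0 ?mulr_ge0 //; lia.
- move=> h; exists (u1 + 1), (u2 - 1), u3; split=> //; clear -u10 u20 u30; lia.
- move=> h; exists (u1 + 1), u2, (u3 - 1); split=> //; clear -u10 u20 u30; lia.
Qed.

(** The coordinates of [n t - s u] sum to zero, so up to a permutation their signs match one of the
    two previous lemmas. The conditions on zero coordinates ensure that a step only lowers a
    positive coordinate of [u]. *)
Lemma nearer_nonneg (n u1 u2 u3 t1 t2 t3 : int) :
  0 < n -> 0 <= u1 -> 0 <= u2 -> 0 <= u3 ->
  (u1 = 0 -> 0 <= t1) -> (u2 = 0 -> 0 <= t2) -> (u3 = 0 -> 0 <= t3) ->
  u1 + u2 + u3 = n -> `|t1| + `|t2| + `|t3| = n ->
  (t1, t2, t3) <> (u1, u2, u3) ->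
  nearer u1 u2 u3 t1 t2 t3.
Proof.
move=> n0 u10 u20 u30 z1 z2 z3 un tn tu; set s := t1 + t2 + t3.
have P (u t : int) : 0 <= u -> (u = 0 -> 0 <= t) -> n * t - s * u < 0 -> 1 <= u.
  move=> u0 z; case: (eqVneq u 0) => [ue|]; last by clear -u0; lia.
  by rewrite ue mulr0 subr0 ltNge mulr_ge0 ?z // ltW.
have sum0 : (n * t1 - s * u1) + (n * t2 - s * u2) + (n * t3 - s * u3) = 0.
  by rewrite /s -un; ring.
have sP : t2 + t1 + t3 = s by rewrite /s; ring.
have sQ : t1 + t3 + t2 = s by rewrite /s; ring.
have sR : t3 + t1 + t2 = s by rewrite /s; ring.
have sS : t2 + t3 + t1 = s by rewrite /s; ring.
have N3 : 1 <= u3 -> 0 <= n * t1 - s * u1 -> 0 <= n * t2 - s * u2 ->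
    nearer u1 u2 u3 t1 t2 t3.
  by move=> h a b; apply: (nearer_neg3 n).
have N2 : 1 <= u2 -> 0 <= n * t1 - s * u1 -> 0 <= n * t3 - s * u3 ->
    nearer u1 u2 u3 t1 t2 t3.
  move=> h a b; apply: nearer_swap23; apply: (nearer_neg3 n); rewrite ?sQ //.
  - by clear -un; lia.
  - by clear -tn; lia.
  - by case=> e1 e2 e3; apply: tu; rewrite e1 e2 e3.
have N1 : 1 <= u1 -> 0 <= n * t2 - s * u2 -> 0 <= n * t3 - s * u3 ->
    nearer u1 u2 u3 t1 t2 t3.
  move=> h a b; apply: nearer_swap12; apply: nearer_swap23.
  apply: (nearer_neg3 n); rewrite ?sS //.
  - by clear -un; lia.
  - by clear -tn; lia.
  - by case=> e1 e2 e3; apply: tu; rewrite e1 e2 e3.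
have [c1|/[dup] d1 /(P _ _ u10 z1) c1] := leP 0 (n * t1 - s * u1);
have [c2|/[dup] d2 /(P _ _ u20 z2) c2] := leP 0 (n * t2 - s * u2);
have [c3|/[dup] d3 /(P _ _ u30 z3) c3] := leP 0 (n * t3 - s * u3).
(* All three differences are nonnegative with sum zero, so any positive coordinate of [u] can be the
   one lowered. *)
- have : [|| 1 <= u1, 1 <= u2 | 1 <= u3] by clear -n0 un u10 u20 u30; lia.
  by case/or3P => h; [apply: N1 | apply: N2 | apply: N3].
- exact: N3.
- exact: N2.
- by apply: (nearer_neg23 n) => //; apply: ltW.
- exact: N1.
- apply: nearer_swap12; apply: (nearer_neg23 n); rewrite ?sP //; try exact: ltW.
  + by clear -un; lia.
  + by clear -tn; lia.
  + by case=> e1 e2 e3; apply: tu; rewrite e1 e2 e3.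
- apply: nearer_swap23; apply: nearer_swap12; apply: (nearer_neg23 n); rewrite ?sR //;
  try exact: ltW.
  + by clear -un; lia.
  + by clear -tn; lia.
  + by case=> e1 e2 e3; apply: tu; rewrite e1 e2 e3.
- by move: sum0 d1 d2 d3; clearbody s; clear; lia.
Qed.

(** Where [u] vanishes its sign is free and is taken from [t], which yields the conditions on zero
    coordinates in [nearer_nonneg]. *)
Lemma sign_exists (u t : int) :
  exists s : int, [/\ s * s = 1, s * u = `|u| & (s * u = 0 -> 0 <= s * t)].
Proof.
have [u0|u0|->] := ltgtP u 0.
- by exists (-1); split; lia.
- by exists 1; split; lia.
by have [t0|t0] := leP 0 t; [exists 1 | exists (-1)]; split; lia.
Qed.

Lemma nearer_exists (n u1 u2 u3 t1 t2 t3 : int) :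
  0 < n -> `|u1| + `|u2| + `|u3| = n -> `|t1| + `|t2| + `|t3| = n ->
  (t1, t2, t3) <> (u1, u2, u3) -> nearer u1 u2 u3 t1 t2 t3.
Proof.
move=> n0 un tn tu.
have [s1 [q1 a1 b1]] := sign_exists u1 t1.
have [s2 [q2 a2 b2]] := sign_exists u2 t2.
have [s3 [q3 a3 b3]] := sign_exists u3 t3.
apply: (nearer_sign s1 s2 s3) => //; apply: (nearer_nonneg n) => //.
- by rewrite a1.
- by rewrite a2.
- by rewrite a3.
- by rewrite a1 a2 a3.
- by rewrite !sign_mul_norm.
have K (s x y : int) : s * s = 1 -> s * x = s * y -> x = y.
  by move=> e /(congr1 ( *%R s)); rewrite !mulrA e !mul1r.
case=> /(K _ _ _ q1) e1 /(K _ _ _ q2) e2 /(K _ _ _ q3) e3; apply: tu.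
by rewrite e1 e2 e3.
Qed.

(** * Vertices as integer triples *)

Lemma crd_inj n : injective (@crd n).
Proof. by move=> a b; rewrite /crd => h; apply: val_inj => /=; lia. Qed.

Lemma crd_surj (n : nat) (a : int) :
  `|a| <= n%:Z -> exists b : 'I_(2 * n + 1), crd b = a.
Proof.
move=> h; have k : (`|(a + n%:Z)%R| < 2 * n + 1)%N by lia.
by exists (Ordinal k); rewrite /crd /=; lia.
Qed.

Lemma V_norm n (v : V n) : `|c1 v| + `|c2 v| + `|c3 v| = n%:Z.
Proof. by have /eqP := valP v; rewrite /c1 /c2 /c3; lia. Qed.

Lemma V_inj n (u v : V n) : c1 u = c1 v -> c2 u = c2 v -> c3 u = c3 v -> u = v.
Proof.
case: u v => [[[u1 u2] u3] hu] [[[v1 v2] v3] hv].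
rewrite /c1 /c2 /c3 /x1 /x2 /x3 /= => /crd_inj e1 /crd_inj e2 /crd_inj e3.
by apply: val_inj; rewrite /= e1 e2 e3.
Qed.

Lemma V_surj (n : nat) (a b c : int) : `|a| + `|b| + `|c| = n%:Z ->
  exists v : V n, [/\ c1 v = a, c2 v = b & c3 v = c].
Proof.
move=> h.
have [|x hx] := crd_surj n a; first lia.
have [|y hy] := crd_surj n b; first lia.
have [|z hz] := crd_surj n c; first lia.
have k : onsphere (x, y, z) by rewrite /onsphere /x1 /x2 /x3 /= hx hy hz; lia.
by exists (exist (fun x : Box n => onsphere x) (x, y, z) k).
Qed.

(** The default [d] is returned when the triple is not on the octahedron. *)
Definition mkV {n : nat} (d : V n) (a b c : int) : V n :=
  odflt d [pick v : V n | [&& c1 v == a, c2 v == b & c3 v == c]].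

Lemma mkVP n (d : V n) (a b c : int) : `|a| + `|b| + `|c| = n%:Z ->
  [/\ c1 (mkV d a b c) = a, c2 (mkV d a b c) = b & c3 (mkV d a b c) = c].
Proof.
move=> /V_surj [v [e1 e2 e3]]; rewrite /mkV; case: pickP => /=.
  by move=> w /and3P [/eqP -> /eqP -> /eqP ->].
by move/(_ v); rewrite e1 e2 e3 !eqxx.
Qed.

(** [cosang] with values in the real field [algR], whose order is total; [cosangE] makes the
    link. *)
Definition cosV {n : nat} (v t : V n) : algR :=
  cosn (c1 v) (c2 v) (c3 v) (c1 t) (c2 t) (c3 t) / rt (dot t t).

Lemma dot_gt0 n (v : V n) : (0 < n)%N -> 0 < dot v v.
Proof. by move=> n0; apply: dot3_gt0; rewrite V_norm; lia. Qed.

Lemma cosangE n (v t : V n) : (0 < n)%N -> cosang v t = val (cosV v t).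
Proof.
have r (x : int) : 0 <= x -> sqrtC x%:~R = algRval (rt x).
  by move=> x0; rewrite /= ger0_norm.
move=> n0; rewrite /cosang /cosV /cosn -/(dot v v) -/(dot v t) -mulrA -invfM.
rewrite -/(algRval _) !r ?ltW ?dot_gt0 //.
by rewrite (rmorphM algRval) (fmorphV algRval) (rmorphM algRval) (rmorph_int algRval).
Qed.

Lemma progress n (u t : V n) : (0 < n)%N -> u != t ->
  exists w : V n, adj u w /\ cosV u t < cosV w t.
Proof.
move=> n0 ut.
have [] := @nearer_exists n%:Z (c1 u) (c2 u) (c3 u) (c1 t) (c2 t) (c3 t).
- by lia.
- exact: V_norm.
- exact: V_norm.
- by case=> e1 e2 e3; move/eqP: ut; apply; apply: V_inj.
move=> w1 [w2 [w3 [h1 h2 h3 h4 h5]]].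
have [|w [e1 e2 e3]] := V_surj n w1 w2 w3; first by rewrite h4 V_norm.
have lt : cosV u t < cosV w t.
  by rewrite /cosV e1 e2 e3 ltr_pM2r // invr_gt0; apply/rt_gt0/dot_gt0.
exists w; split=> //; rewrite /adj e1 e2 e3 h1 h2 h3 !andbT.
by apply: contraTneq lt => ->; rewrite ltxx.
Qed.

(** * Angle versus L1 distance *)

Lemma sum3_sqr_le {R : realFieldType} (a b c : R) :
  (a + b + c) ^+ 2 <= 3 * (a ^+ 2 + b ^+ 2 + c ^+ 2).
Proof.
have := sqr_ge0 (a - b); have := sqr_ge0 (a - c); have := sqr_ge0 (b - c).
rewrite !expr2; lra.
Qed.

Lemma sqr_sum3_ge {R : realFieldType} (a b c : R) :
  a ^+ 2 + b ^+ 2 + c ^+ 2 <= (`|a| + `|b| + `|c|) ^+ 2.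
Proof.
rewrite -(real_normK (num_real a)) -(real_normK (num_real b)) -(real_normK (num_real c)).
have ab : 0 <= `|a| * `|b| by rewrite mulr_ge0.
have ac : 0 <= `|a| * `|c| by rewrite mulr_ge0.
have bc : 0 <= `|b| * `|c| by rewrite mulr_ge0.
rewrite !expr2; lra.
Qed.

Section Chord.
Context {R : realFieldType}.
Variables (n x y u1 u2 u3 t1 t2 t3 : R).
Hypothesis n0 : 0 < n.
Hypothesis x0 : 0 < x.
Hypothesis y0 : 0 < y.
Hypothesis ux : u1 ^+ 2 + u2 ^+ 2 + u3 ^+ 2 = x ^+ 2.
Hypothesis ty : t1 ^+ 2 + t2 ^+ 2 + t3 ^+ 2 = y ^+ 2.
Hypothesis un : `|u1| + `|u2| + `|u3| = n.
Hypothesis tn : `|t1| + `|t2| + `|t3| = n.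

Let d := u1 * t1 + u2 * t2 + u3 * t3.
Let l := `|u1 - t1| + `|u2 - t2| + `|u3 - t3|.

Lemma norm2_le : x <= n.
Proof.
rewrite -(@ler_pXn2r _ 2) ?nnegrE ?(ltW x0) ?(ltW n0) // -ux -un; exact: sqr_sum3_ge.
Qed.

Lemma norm2_ge : n ^+ 2 <= 3 * x ^+ 2.
Proof.
rewrite -ux -un; have := sum3_sqr_le `|u1| `|u2| `|u3|.
by rewrite !real_normK ?num_real.
Qed.

(** Rescaling to [y u] and [x t], both of Euclidean norm [x y], makes the squared distance exactly
    [2 x y (x y - d)]; the rescaling at most doubles the L1 error, and [x <= n] finishes. The
    constant 24 is [2 ^ 2 * 6]. *)
Lemma chord_lower : l ^+ 2 <= 24 * n ^+ 2 * (1 - d / x / y).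
Proof.
pose E := `|y * u1 - x * t1| + `|y * u2 - x * t2| + `|y * u3 - x * t3|.
have K (u t : R) : y * `|u - t| <= `|y * u - x * t| + `|x - y| * `|t|.
  rewrite -{1}(gtr0_norm y0) -!normrM.
  have -> : y * (u - t) = (y * u - x * t) + (x - y) * t by ring.
  exact: ler_normD.
have K' (u t : R) : x * `|t| <= `|y * u - x * t| + y * `|u|.
  rewrite -{1}(gtr0_norm x0) -{2}(gtr0_norm y0) -!normrM.
  rewrite {1}(_ : x * t = - (y * u - x * t) + y * u); last by ring.
  by rewrite (le_trans (ler_normD _ _)) // normrN.
have K2 (u t : R) : y * `|u| <= `|y * u - x * t| + x * `|t|.
  rewrite -{1}(gtr0_norm y0) -{2}(gtr0_norm x0) -!normrM.
  rewrite {1}(_ : y * u = (y * u - x * t) + x * t); last by ring.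
  by rewrite (le_trans (ler_normD _ _)) // normrN.
(* Since [u] and [t] both have L1 norm [n], the L1 norms of [y u] and [x t] differ by [|x - y| n],
   which [E] therefore bounds. *)
have H1 : x * n - y * n <= E.
  have := K' u1 t1; have := K' u2 t2; have := K' u3 t3.
  rewrite -{1}tn -un /E; lra.
have H2 : y * n - x * n <= E.
  have := K2 u1 t1; have := K2 u2 t2; have := K2 u3 t3.
  rewrite -{1}un -tn /E; lra.
have H3 : `|x - y| * n <= E.
  rewrite -(gtr0_norm n0) -normrM ler_norml mulrBl; lra.
have H4 : y * l <= 2 * E.
  have := K u1 t1; have := K u2 t2; have := K u3 t3.
  have : `|x - y| * `|t1| + `|x - y| * `|t2| + `|x - y| * `|t3| <= E.
    by rewrite -!mulrDr tn.
  rewrite /l /E; lra.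
have l0 : 0 <= l by rewrite /l !addr_ge0.
have H5 : (y * l) ^+ 2 <= (2 * E) ^+ 2.
  rewrite ler_pXn2r ?nnegrE ?mulr_ge0 ?(ltW y0) //.
  by rewrite /E !addr_ge0.
(* Here 6 is the factor 3 of [sum3_sqr_le] times the factor 2 of the squared distance. *)
have H6 : E ^+ 2 <= 6 * (x * y) * (x * y - d).
  have := sum3_sqr_le `|y * u1 - x * t1| `|y * u2 - x * t2| `|y * u3 - x * t3|.
  rewrite !real_normK ?num_real // -/E => /le_trans; apply.
  rewrite le_eqVlt; apply/orP; left; apply/eqP.
  transitivity (3 * (y ^+ 2 * (u1 ^+ 2 + u2 ^+ 2 + u3 ^+ 2) +
     x ^+ 2 * (t1 ^+ 2 + t2 ^+ 2 + t3 ^+ 2) - 2 * (x * y) * d)).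
    by rewrite /d; ring.
  by rewrite ux ty; ring.
have y2 : 0 < y ^+ 2 by rewrite exprn_gt0.
rewrite -(ler_pM2l y2) -exprMn.
apply: (le_trans H5); rewrite exprMn.
have xyd : 0 <= x * y - d.
  have : 0 <= E ^+ 2 by exact: sqr_ge0.
  move=> /le_trans /(_ H6); rewrite pmulr_rge0 // mulr_gt0 ?mulr_gt0 //; lra.
have -> : y ^+ 2 * (24 * n ^+ 2 * (1 - d / x / y)) =
  24 * n ^+ 2 * (y / x) * (x * y - d).
  by field; rewrite !gt_eqF.
have H7 : x * y <= n ^+ 2 * (y / x).
  rewrite [leRHS]mulrA ler_pdivlMr // mulrAC -expr2 ler_wpM2r ?(ltW y0) //.
  by rewrite ler_pXn2r ?nnegrE ?norm2_le ?(ltW x0) ?(ltW n0).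
have : x * y * (x * y - d) <= n ^+ 2 * (y / x) * (x * y - d) by rewrite ler_wpM2r.
move: H6; rewrite [2 ^+ 2]expr2; lra.
Qed.
End Chord.

(** [2 (x y - d)] is the squared Euclidean distance of [u] and [t] minus [(x - y) ^ 2], hence at
    most [l ^ 2]; and [n ^ 2 <= 3 x y] because both [3 x ^ 2] and [3 y ^ 2] are at least [n ^ 2]. *)
Lemma chord_upper {R : realFieldType} (n x y u1 u2 u3 t1 t2 t3 : R) :
  0 < n -> 0 < x -> 0 < y ->
  u1 ^+ 2 + u2 ^+ 2 + u3 ^+ 2 = x ^+ 2 -> t1 ^+ 2 + t2 ^+ 2 + t3 ^+ 2 = y ^+ 2 ->
  `|u1| + `|u2| + `|u3| = n -> `|t1| + `|t2| + `|t3| = n ->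
  2 * n ^+ 2 * (1 - (u1 * t1 + u2 * t2 + u3 * t3) / x / y) <=
  3 * (`|u1 - t1| + `|u2 - t2| + `|u3 - t3|) ^+ 2.
Proof.
move=> n0 x0 y0 ux ty un tn.
set d := u1 * t1 + u2 * t2 + u3 * t3.
set l := `|u1 - t1| + `|u2 - t2| + `|u3 - t3|.
have nx := norm2_ge _ _ _ _ _ ux un; have ny := norm2_ge _ _ _ _ _ ty tn.
have xy0 : 0 < x * y by rewrite mulr_gt0.
have H1 : n ^+ 2 <= 3 * (x * y).
  rewrite -(@ler_pXn2r _ 2) ?nnegrE ?sqr_ge0 ?mulr_ge0 ?(ltW x0) ?(ltW y0) //.
  have -> : (3 * (x * y)) ^+ 2 = (3 * x ^+ 2) * (3 * y ^+ 2) by ring.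
  by rewrite [leLHS]expr2 ler_pM ?sqr_ge0.
have H2 : 2 * (x * y - d) <= l ^+ 2.
  apply: le_trans (sqr_sum3_ge _ _ _).
  have : 0 <= (x - y) ^+ 2 by exact: sqr_ge0.
  rewrite /d; move: ux ty; rewrite !expr2; lra.
have -> : 1 - d / x / y = (x * y - d) / (x * y) by field; rewrite !gt_eqF.
rewrite mulrA ler_pdivrMr //.
have [xyd|xyd] := lerP 0 (x * y - d).
  have : n ^+ 2 * (2 * (x * y - d)) <= 3 * (x * y) * l ^+ 2.
    by rewrite ler_pM ?sqr_ge0 //; lra.
  lra.
apply: (@le_trans _ _ 0).
  rewrite mulr_ge0_le0 ?mulr_ge0 ?sqr_ge0 //; lra.
by rewrite mulr_ge0 ?(ltW xy0) // mulr_ge0 ?sqr_ge0.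
Qed.

Lemma intr_dot3 (R : pzRingType) (a b c d e f : int) : (dot3 a b c d e f)%:~R =
  a%:~R * d%:~R + b%:~R * e%:~R + c%:~R * f%:~R :> R.
Proof. by rewrite /dot3 !intrD !intrM. Qed.

Definition l1 {n : nat} (u v : V n) : nat :=
  (absz (c1 u - c1 v) + absz (c2 u - c2 v) + absz (c3 u - c3 v))%N.

Definition rho {n : nat} (u t : V n) : algR := 1 - cosV u t.

Section Rho.
Variables (n : nat) (n0 : (0 < n)%N).

Let nR : (0 : algR) < n%:R. Proof. by rewrite ltr0n. Qed.

Let rtV (v : V n) : (c1 v)%:~R ^+ 2 + (c2 v)%:~R ^+ 2 + (c3 v)%:~R ^+ 2 =
  rt (dot v v) ^+ 2 :> algR.
Proof.
rewrite [RHS]expr2 rt_sqr; last by apply: ltW; exact: dot_gt0.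
by rewrite -/(dot3 _ _ _ _ _ _) intr_dot3 -!expr2.
Qed.

Let normV (v : V n) : `|(c1 v)%:~R| + `|(c2 v)%:~R| + `|(c3 v)%:~R| = n%:R :> algR.
Proof. by rewrite -!intr_norm -!intrD V_norm. Qed.

Let l1E (u v : V n) : `|(c1 u)%:~R - (c1 v)%:~R| + `|(c2 u)%:~R - (c2 v)%:~R| +
  `|(c3 u)%:~R - (c3 v)%:~R| = (l1 u v)%:R :> algR.
Proof. by rewrite -!intrB -!intr_norm /l1 !natrD !natr_absz. Qed.

Lemma rho_lower (u t : V n) : (l1 u t ^ 2)%:R <= 24 * n%:R ^+ 2 * rho u t.
Proof.
rewrite natrX -l1E /rho /cosV /cosn intr_dot3.
by apply: chord_lower; rewrite ?rt_gt0 ?dot_gt0.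
Qed.

Lemma rho_upper (u t : V n) : 2 * n%:R ^+ 2 * rho u t <= 3 * (l1 u t ^ 2)%:R.
Proof.
rewrite natrX -l1E /rho /cosV /cosn intr_dot3.
by apply: chord_upper; rewrite ?rt_gt0 ?dot_gt0.
Qed.

End Rho.

(** * Graph distance *)

(* [x] and [y] have opposite signs, so that going from [x] to [y] first decreases
   the absolute value of [x]; [cost] charges extra for this. *)
Definition wrong (x y : int) : bool := ((0 < x) && (y < 0)) || ((x < 0) && (0 < y)).

Definition cost (w : nat) (x y : int) : nat :=
  (absz (x - y) + (if wrong x y then w * absz x else 0))%N.

(** Moving outward from zero, the side of [y] is chosen so that no wrong sign is created. *)
Lemma cost_up (x y : int) : exists x' : int,
  [/\ `|x - x'| <= 1, `|x'| = `|x| + 1 &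
      forall w, (cost w x' y <= cost w x y + 1 + (if wrong x y then w else 0))%N].
Proof.
rewrite /cost /wrong.
have [hx|[hx|[[hx hy]|[hx hy]]]] : 0 < x \/ x < 0 \/ (x = 0 /\ 0 <= y) \/ (x = 0 /\ y < 0) by lia.
- by exists (x + 1); split; [lia | lia |move=> w; do ?case: ifP => ?; nia].
- by exists (x - 1); split; [lia | lia |move=> w; do ?case: ifP => ?; nia].
- by exists 1; split; [lia | lia |move=> w; do ?case: ifP => ?; nia].
- by exists (-1); split; [lia | lia |move=> w; do ?case: ifP => ?; nia].
Qed.

Lemma cost_down_wrong (x y : int) : wrong x y -> exists x' : int,
  [/\ `|x - x'| <= 1, `|x'| = `|x| - 1 &
      forall w, (cost w x' y + 1 + w <= cost w x y)%N].
Proof.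
move=> h; rewrite /cost h; move: h; rewrite /wrong.
move=> h; have [hx|hx] : 0 < x \/ x < 0 by lia.
- by exists (x - 1); split; [lia | lia |move=> w; do ?case: ifP => ?; nia].
- by exists (x + 1); split; [lia | lia |move=> w; do ?case: ifP => ?; nia].
Qed.

Lemma cost_toward (x y : int) : ~~ wrong x y -> `|x| != `|y| -> exists x' : int,
  [/\ `|x - x'| <= 1, `|x'| = `|x| + (if `|x| < `|y| then 1 else -1) &
      forall w, (cost w x' y + 1 <= cost w x y)%N].
Proof.
rewrite /cost => h; rewrite (negbTE h); move: h; rewrite /wrong.
move=> h ne; have [xy|xy] := ltrP `|x| `|y|.
- exists (if 0 < y then x + 1 else x - 1); split; first by case: ifP; lia.
    by case: ifP; lia.
  by move=> w; case: ifP => hy; case: ifP => hw; nia.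
- exists (if 0 < x then x - 1 else x + 1); split; first by case: ifP; lia.
    by case: ifP; lia.
  by move=> w; case: ifP => hy; case: ifP => hw; nia.
Qed.

(** A potential for walking from [u] to [v]: some edge always decreases it, so it bounds the graph
    distance from above, and it is comparable to [l1]. *)
Definition cost3 {n : nat} (u v : V n) : nat :=
  (cost 1 (c1 u) (c1 v) + cost 2 (c2 u) (c2 v) + cost 3 (c3 u) (c3 v))%N.

Lemma cost3_le n (u v : V n) : (cost3 u v <= 4 * l1 u v)%N.
Proof.
have K (w : nat) (x y : int) : (cost w x y <= (w + 1) * absz (x - y))%N.
  rewrite /cost /wrong; case: ifP => [h|_]; last nia.
  have : (absz x <= absz (x - y))%N by lia.
  nia.
have := K 1%N (c1 u) (c1 v); have := K 2%N (c2 u) (c2 v); have := K 3%N (c3 u) (c3 v).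
rewrite /cost3 /l1; lia.
Qed.

(* The weights 1, 2, 3 differ so that when several coordinates have the wrong
   sign, mass can be moved from the heaviest of them to any other. *)
Lemma cost3_step n (u v : V n) : u != v ->
  exists w : V n, adj w u /\ (cost3 w v < cost3 u v)%N.
Proof.
move=> uv.
suff [x [y [z [[hx hy hz] hn hc]]]] : exists x y z : int,
    [/\ [/\ `|c1 u - x| <= 1, `|c2 u - y| <= 1 & `|c3 u - z| <= 1],
      `|x| + `|y| + `|z| = `|c1 u| + `|c2 u| + `|c3 u| &
      (cost 1 x (c1 v) + cost 2 y (c2 v) + cost 3 z (c3 v) < cost3 u v)%N].
  have [|w [e1 e2 e3]] := V_surj n x y z; first by rewrite hn V_norm.
  have lt : (cost3 w v < cost3 u v)%N by rewrite {1}/cost3 e1 e2 e3.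
  exists w; split=> //; rewrite /adj e1 e2 e3.
  rewrite -(distrC (c1 u)) hx -(distrC (c2 u)) hy -(distrC (c3 u)) hz !andbT.
  by apply: contraTneq lt => ->; rewrite ltnn.
have un := V_norm _ u; have vn := V_norm _ v.
rewrite /cost3.
have [x1 [a1 b1 d1]] := cost_up (c1 u) (c1 v).
have [x2 [a2 b2 d2]] := cost_up (c2 u) (c2 v).
(* Lowering the third coordinate gains [1 + 3], while raising the first costs at most [1 + 1]. *)
case w3 : (wrong (c3 u) (c3 v)).
  have [x3 [a3 b3 d3]] := cost_down_wrong _ _ w3.
  exists x1, (c2 u), x3; split; [by split; rewrite ?subrr | |].
    by rewrite b1 b3; clear; lia.
  by have := d1 1%N; have := d3 3%N; clear; case: ifP => _; lia.
case w2 : (wrong (c2 u) (c2 v)).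
  have [x2' [a2' b2' d2']] := cost_down_wrong _ _ w2.
  exists x1, x2', (c3 u); split; [by split; rewrite ?subrr | |].
    by rewrite b1 b2'; clear; lia.
  by have := d1 1%N; have := d2' 2%N; clear; case: ifP => _; lia.
(* The second coordinate is no longer wrong, so raising it costs at most 1, against a gain of
   [1 + 1]. *)
case w1 : (wrong (c1 u) (c1 v)).
  have [x1' [a1' b1' d1']] := cost_down_wrong _ _ w1.
  exists x1', x2, (c3 u); split; [by split; rewrite ?subrr | |].
    by rewrite b1' b2; clear; lia.
  by have := d2 2%N; have := d1' 1%N; rewrite w2; clear; lia.
(* Without wrong signs, two coordinates are sought whose absolute values must move in opposite
   directions; they exist because both triples have L1 norm [n]. *)
clear x1 a1 b1 d1 x2 a2 b2 d2.
have T1 := cost_toward _ _ (negbT w1).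
have T2 := cost_toward _ _ (negbT w2).
have T3 := cost_toward _ _ (negbT w3).
have H (i j k i' j' k' : int) : `|i| + `|j| + `|k| = n%:Z ->
    `|i'| + `|j'| + `|k'| = n%:Z -> `|i| = `|i'| -> `|j| = `|j'| -> `|k| = `|k'|.
  by clear; lia.
have [e1|n1] := eqVneq `|c1 u| `|c1 v|.
  have [e2|n2] := eqVneq `|c2 u| `|c2 v|.
    have e3 := H _ _ _ _ _ _ un vn e1 e2.
    case/eqP: uv; move: w1 w2 w3; rewrite /wrong => w1 w2 w3.
    apply: V_inj; [clear -e1 w1 | clear -e2 w2 | clear -e3 w3]; lia.
  have n3 : `|c3 u| != `|c3 v| by clear -un vn e1 n2; lia.
  have [x2' [p2 q2 r2]] := T2 n2; have [x3' [p3 q3 r3]] := T3 n3.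
  exists (c1 u), x2', x3'; split; first by split; [rewrite subrr | |].
    by move: q2 q3; case: ifP; case: ifP; clear -un vn e1 n2 n3; lia.
  have := r2 2%N; have := r3 3%N; clear; lia.
have [e2|n2] := eqVneq `|c2 u| `|c2 v|.
  have n3 : `|c3 u| != `|c3 v| by clear -un vn e2 n1; lia.
  have [x1' [p1 q1 r1]] := T1 n1; have [x3' [p3 q3 r3]] := T3 n3.
  exists x1', (c2 u), x3'; split; first by split; [ | rewrite subrr |].
    by move: q1 q3; case: ifP; case: ifP; clear -un vn e2 n1 n3; lia.
  have := r1 1%N; have := r3 3%N; clear; lia.
have [x1' [p1 q1 r1]] := T1 n1; have [x2' [p2 q2 r2]] := T2 n2.
have [s|s] := boolP ((`|c1 u| < `|c1 v|) == (`|c2 u| < `|c2 v|)); last first.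
  exists x1', x2', (c3 u); split; first by split; [ | | rewrite subrr].
    by move: q1 q2 s; case: ifP; case: ifP; clear; lia.
  have := r1 1%N; have := r2 2%N; clear; lia.
have n3 : `|c3 u| != `|c3 v| by move: s; clear -un vn n1 n2; lia.
have [x3' [p3 q3 r3]] := T3 n3.
exists x1', (c2 u), x3'; split; first by split; [ | rewrite subrr |].
  by move: q1 q3 s; case: ifP; case: ifP; clear -un vn n1 n2 n3; lia.
have := r1 1%N; have := r3 3%N; clear; lia.
Qed.

Lemma mem_ball_cost3 n k (u v : V n) : (cost3 v u <= k)%N -> v \in ball k u.
Proof.
elim: k v => [|k IH] v h.
  have [->|/cost3_step [w [_ lt]]] := eqVneq v u; first by rewrite inE.
  by move: lt; rewrite ltnNge (leq_trans h).
rewrite /= inE inE.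
have [->|/cost3_step [w [a lt]]] := eqVneq v u.
  by rewrite IH // (leq_trans (cost3_le _ _ _)) // /l1 !subrr.
apply/orP; right; apply/existsP; exists w; rewrite a andbT.
by rewrite IH // -ltnS (leq_trans lt).
Qed.

Lemma dist_le_ball n k (u v : V n) : v \in ball k u -> (dist u v <= k)%N.
Proof.
move=> vk; rewrite /dist -minEnat -leEnat.
(* If [k] is outside the range of the minimum, the default value [#|V n|] is already at most [k]. *)
have [kV|Vk] := ltnP k #|V n|.
  exact: (bigmin_le_cond _ (fun i : 'I_#|V n| => i : nat) (j := Ordinal kV)).
by apply: (@le_trans _ _ #|V n|); [exact: bigmin_le_id | exact: Vk].
Qed.

Lemma dist_le n (u v : V n) : (dist u v <= 4 * l1 u v)%N.
Proof.
apply: dist_le_ball; apply: mem_ball_cost3; apply: leq_trans (cost3_le _ _ _) _.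
by rewrite /l1; lia.
Qed.

(** * Maximum-norm distance and the normalising sum *)

Definition linf {n : nat} (u v : V n) : nat :=
  maxn (absz (c1 u - c1 v)) (maxn (absz (c2 u - c2 v)) (absz (c3 u - c3 v))).

Lemma linf_ball n k (u v : V n) : v \in ball k u -> (linf u v <= k)%N.
Proof.
elim: k v => [|k IH] v /=; first by rewrite inE => /eqP ->; rewrite /linf; lia.
rewrite !inE => /orP [/IH/leq_trans -> //|/existsP [w /andP [/IH]]].
rewrite /adj /linf !geq_max => /and3P [a1 a2 a3] /and4P [_ b1 b2 b3].
have K (x y z : int) : (absz (x - y) <= k)%N -> `|y - z| <= 1 -> (absz (x - z) <= k.+1)%N.
  by clear; lia.
by rewrite !(K _ _ _ _ b1, K _ _ _ _ b2, K _ _ _ _ b3).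
Qed.

Lemma linf_le n (u v : V n) : (linf u v <= 2 * n)%N.
Proof.
have := V_norm _ u; have := V_norm _ v; rewrite /linf !geq_max => a b.
by apply/and3P; split; lia.
Qed.

Lemma linf_gt0 n (u v : V n) : u != v -> (0 < linf u v)%N.
Proof.
apply: contraNT => h; apply/eqP/V_inj; move: h; rewrite /linf; lia.
Qed.

(** This makes the default value of [dist] dominate [linf]. The vertices counted have third
    coordinate 0, a nonnegative second coordinate and an arbitrary first one. *)
Lemma card_V_ge n (u : V n) : (2 * n <= #|V n|)%N.
Proof.
pose f (i : 'I_(2 * n + 1)) : V n := mkV u (crd i) (n%:Z - `|crd i|) 0.
have fi : injective f.
  move=> i j e; apply: crd_inj.
  have N (k : 'I_(2 * n + 1)) : `|crd k| + `|n%:Z - `|crd k| | + `|0 : int| = n%:Z.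
    by have := ltn_ord k; rewrite /crd; lia.
  have [<- _ _] := mkVP n u _ _ _ (N i); have [<- _ _] := mkVP n u _ _ _ (N j).
  by rewrite -/(f i) e.
by have := leq_card f fi; rewrite card_ord; lia.
Qed.

Lemma dist_ge n (u v : V n) : (linf u v <= dist u v)%N.
Proof.
rewrite /dist; apply: (big_ind (fun d => linf u v <= d)%N) => [|x y hx hy|k hk].
- exact: leq_trans (linf_le _ _ _) (card_V_ge _ u).
- by rewrite leq_min hx.
- exact: linf_ball.
Qed.

(** On the octahedron a vertex is determined by two coordinates and the sign of the third, so the
    count is quadratic in [m]. *)
Lemma card_linf_lt n (u : V n) m :
  (#|[set w | linf u w < m]| <= 2 * (2 * m).+1 ^ 2)%N.
Proof.
pose f (w : V n) : 'I_(2 * m).+1 * 'I_(2 * m).+1 * bool :=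
  (inord (absz (c1 w - c1 u + m%:Z)), inord (absz (c2 w - c2 u + m%:Z)), 0 <= c3 w).
have fi : {in [set w | linf u w < m]%N &, injective f}.
  have K (x y z : int) : (absz (z - x) < m)%N -> (absz (z - y) < m)%N ->
      inord (absz (x - z + m%:Z)) = inord (absz (y - z + m%:Z)) :> 'I_(2 * m).+1 ->
      x = y.
    move=> hx hy /(congr1 val) /=; rewrite !inordK; clear -hx hy; lia.
  move=> v w; rewrite !inE /linf !gtn_max => /and3P [h1 h2 h3] /and3P [k1 k2 k3] [].
  move=> /(K _ _ _ h1 k1) e1 /(K _ _ _ h2 k2) e2 e3.
  apply: V_inj => //.
  by have := V_norm _ v; have := V_norm _ w; rewrite e1 e2; clear -e3; lia.
rewrite -(card_in_imset fi); apply: leq_trans (max_card _) _.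
by rewrite !card_prod card_bool !card_ord; lia.
Qed.

Definition lrsum {n : nat} (u : V n) : algR :=
  \sum_(w : V n | w != u) ((dist u w ^ 2)%:R)^-1.

(** The shell [2 ^ j <= linf u w < 2 ^ j.+1] has at most [72 * 4 ^ j] vertices, each contributing at
    most [1 / 4 ^ j]; since [linf u w <= 2 * n < 2 ^ J], there are [J] shells. *)
Lemma lrsum_le n (u : V n) : (0 < n)%N ->
  lrsum u <= 72 * (trunc_log 2 n).+2%:R.
Proof.
move=> n0; set J := (trunc_log 2 n).+2.
have lgP (w : V n) : w != u ->
    (2 ^ trunc_log 2 (linf u w) <= linf u w < 2 ^ (trunc_log 2 (linf u w)).+1)%N.
  by move=> wu; apply: trunc_log_bounds; rewrite ?linf_gt0 // eq_sym.
have lgJ (w : V n) : w != u -> (trunc_log 2 (linf u w) < J)%N.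
  move=> wu; have /andP [h _] := lgP w wu.
  rewrite -(@ltn_exp2l 2) //; apply: leq_ltn_trans h _.
  apply: leq_ltn_trans (linf_le _ _ _) _.
  rewrite /J expnS ltn_pmul2l //; exact: trunc_log_ltn.
rewrite /lrsum; pose P (j : 'I_J) (w : V n) := trunc_log 2 (linf u w) == j.
apply: (@le_trans _ _ (\sum_(w : V n | w != u) \sum_(j < J | P j w) ((4 ^ j)%:R)^-1)).
  apply: ler_sum => w wu.
  rewrite (big_pred1 (Ordinal (lgJ w wu))) => [|j]; last first.
    by rewrite /P /= -(inj_eq val_inj) /= eq_sym.
  have /andP [h _] := lgP w wu.
  rewrite lef_pV2 ?posrE ?ltr0n ?expn_gt0 //=; last first.
    by rewrite (leq_trans (linf_gt0 _ _ _ _) (dist_ge _ _ _)) // eq_sym.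
  by rewrite ler_nat (_ : 4 = 2 ^ 2)%N // expnAC leq_exp2r // (leq_trans h) ?dist_ge.
rewrite (exchange_big_dep xpredT) //=.
apply: (@le_trans _ _ (\sum_(j < J) 72)); last first.
  by rewrite sumr_const card_ord mulr_natr.
apply: ler_sum => j _.
rewrite sumr_const -[leLHS]mulr_natl ler_pdivrMr ?ltr0n ?expn_gt0 // -natrM ler_nat.
apply: (@leq_trans (2 * (2 * 2 ^ j.+1).+1 ^ 2)).
  apply: leq_trans (card_linf_lt n u _); apply: subset_leq_card.
  apply/fintype.subsetP => w; rewrite !inE => /andP [wu /eqP <-].
  by have /andP [] := lgP w wu.
have -> : (4 ^ j = 2 ^ j * 2 ^ j)%N by rewrite -expnMn.
rewrite (expnS 2 j) -mulnn.
have : (0 < 2 ^ j)%N by rewrite expn_gt0.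
move: (2 ^ j)%N => x; nia.
Qed.

(** * Many vertices near the target, and the probability of a good contact *)

Lemma outward_sign (x : int) : exists s : int,
  (forall a : nat, `|x + s * a%:Z| = `|x| + a%:Z /\ `|s * a%:Z| = a%:Z) /\
  (forall a : nat, a%:Z <= `|x| -> `|x - s * a%:Z| = `|x| - a%:Z).
Proof. by have [h|h] := leP 0 x; [exists 1 | exists (-1)]; split=> a; lia. Qed.

(* [f1], [f2], [f3] are the coordinates of [(r + 1)^2] points near [t]; they are
   obtained by increasing two coordinates of [t] in absolute value and decreasing
   the largest one. *)
Definition patch (n t1 t2 t3 : int) (r : nat) : Prop :=
  exists f1 f2 f3 : nat -> nat -> int,
    (forall a b, (a <= r)%N -> (b <= r)%N ->
      `|f1 a b| + `|f2 a b| + `|f3 a b| = n /\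
      `|f1 a b - t1| + `|f2 a b - t2| + `|f3 a b - t3| <= (4 * r)%:Z) /\
    (forall a b a' b', f1 a b = f1 a' b' -> f2 a b = f2 a' b' ->
      f3 a b = f3 a' b' -> a = a' /\ b = b').

(** As [|t3| >= 8 r], the third coordinate can absorb the decrease [a + b <= 2 r]; the total
    displacement is [2 (a + b) <= 4 r]. *)
Lemma patch_large (n t1 t2 t3 : int) r : (24 * r)%:Z <= n ->
  `|t1| + `|t2| + `|t3| = n -> n <= 3 * `|t3| -> patch n t1 t2 t3 r.
Proof.
move=> rn N h.
have [s1 [p1 _]] := outward_sign t1; have [s2 [p2 _]] := outward_sign t2.
have [s3 [q3 p3]] := outward_sign t3.
exists (fun a _ => t1 + s1 * a%:Z), (fun _ b => t2 + s2 * b%:Z).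
exists (fun a b => t3 - s3 * (a + b)%N%:Z); split.
  move=> a b ha hb.
  have [e1 f1] := p1 a; have [e2 f2] := p2 b; have [_ f3] := q3 (a + b)%N.
  have k : (a + b)%N%:Z <= `|t3| by clear -ha hb rn h; lia.
  rewrite e1 e2 p3 //.
  have -> : `|t3 - s3 * (a + b)%N%:Z - t3| = (a + b)%N%:Z.
    by rewrite addrAC subrr sub0r normrN.
  rewrite !(addrAC _ _ (- _)) !subrr !add0r f1 f2; clear -N ha hb; lia.
have K (s t : int) (p : forall a : nat, `|t + s * a%:Z| = `|t| + a%:Z /\ `|s * a%:Z| = a%:Z)
    (a b : nat) : t + s * a%:Z = t + s * b%:Z -> a = b.
  by move=> e; have [x _] := p a; have [y _] := p b; move: x; rewrite e y; clear; lia.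
by move=> a b a' b' /(K _ _ p1) -> /(K _ _ p2) ->.
Qed.

Lemma patch_exists (n t1 t2 t3 : int) r : (24 * r)%:Z <= n ->
  `|t1| + `|t2| + `|t3| = n -> patch n t1 t2 t3 r.
Proof.
move=> rn N.
have : [\/ n <= 3 * `|t3|, n <= 3 * `|t2| | n <= 3 * `|t1| ].
  by apply/or3P; clear -N; lia.
case=> h.
- exact: patch_large.
- have [|f1 [f2 [f3 [P I]]]] := patch_large n t1 t3 t2 r rn _ h; first by clear -N; lia.
  exists f1, f3, f2; split=> [a b ha hb|a b a' b' e1 e3 e2]; last exact: I.
  by have := P a b ha hb; clear; lia.
- have [|f1 [f2 [f3 [P I]]]] := patch_large n t3 t2 t1 r rn _ h; first by clear -N; lia.
  exists f3, f2, f1; split=> [a b ha hb|a b a' b' e3 e2 e1]; last exact: I.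
  by have := P a b ha hb; clear; lia.
Qed.

Lemma many_near n (t : V n) r : (24 * r <= n)%N ->
  exists f : 'I_r.+1 * 'I_r.+1 -> V n,
    injective f /\ (forall p, (l1 (f p) t <= 4 * r)%N).
Proof.
move=> rn.
have [|f1 [f2 [f3 [P I]]]] := patch_exists n%:Z (c1 t) (c2 t) (c3 t) r _ (V_norm _ t).
  by clear -rn; lia.
pose f (p : 'I_r.+1 * 'I_r.+1) := mkV t (f1 p.1 p.2) (f2 p.1 p.2) (f3 p.1 p.2).
have Q (p : 'I_r.+1 * 'I_r.+1) := P p.1 p.2 (ltn_ord p.1) (ltn_ord p.2).
exists f; split.
  move=> p p' e.
  have [a1 a2 a3] := mkVP n t _ _ _ (Q p).1.
  have [b1 b2 b3] := mkVP n t _ _ _ (Q p').1.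
  move: a1 a2 a3; rewrite -/(f p) e b1 b2 b3 => /esym h1 /esym h2 /esym h3.
  have [] := I _ _ _ _ h1 h2 h3.
  by case: (p) (p') => x y [x' y'] /= /val_inj -> /val_inj ->.
move=> p; have [a1 a2 a3] := mkVP n t _ _ _ (Q p).1.
by rewrite /l1 a1 a2 a3; have := (Q p).2; clear; lia.
Qed.

Definition near_set {n : nat} (u t : V n) : {set V n} :=
  [set v | 4 * rho v t <= rho u t].

Definition lrp {n : nat} (u v : V n) : algR :=
  if v == u then 0 else (lrsum u)^-1 / (dist u v ^ 2)%:R.

Lemma rho_gt0 n (u t : V n) : (0 < n)%N -> u != t -> 0 < rho u t.
Proof.
move=> n0 ut.
have d0 : (0 < l1 u t ^ 2)%N.
  rewrite expn_gt0; have := linf_gt0 _ _ _ ut.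
  by rewrite /linf !leq_max /l1; lia.
have := rho_lower _ n0 u t; rewrite -(ltr0n algR) in d0.
move=> /(lt_le_trans d0); rewrite pmulr_rgt0 // mulr_gt0 // exprn_gt0 //.
by rewrite ltr0n.
Qed.

(** [many_near] supplies [r.+1 ^ 2 >= (D / 48) ^ 2] vertices of [near_set u t], each within graph
    distance [8 * D] of [u]; hence the constant [384 = 8 * 48]. *)
Lemma lrp_near_ge n (u t : V n) : (0 < n)%N -> u != t ->
  (lrsum u)^-1 / 384 ^+ 2 <= \sum_(v in near_set u t) lrp u v.
Proof.
move=> n0 ut; set D := l1 u t; set r := (D %/ 48)%N.
have s0 : 0 <= (lrsum u)^-1.
  by rewrite invr_ge0 sumr_ge0 // => w _; rewrite invr_ge0 ler0n.
have rD : (48 * r <= D)%N by rewrite mulnC leq_divM.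
have Dr : (D <= 48 * r.+1)%N by rewrite ltnW // mulnC ltn_ceil.
have Dn : (D <= 2 * n)%N.
  have := V_norm _ u; have := V_norm _ t; rewrite /D /l1; clear; lia.
have [|f [fi fP]] := many_near n t r; first by clear -rD Dn; lia.
have D0 : (0 < D)%N.
  have := linf_gt0 _ _ _ ut; rewrite /linf !leq_max /D /l1; clear; lia.
have near p : f p \in near_set u t.
  rewrite inE.
  have up := rho_upper _ n0 (f p) t; have lo := rho_lower _ n0 u t.
  (* The choice of 48 matches [3 * 48 * (4 * r) ^ 2 = (48 * r) ^ 2]; the two bounds on [rho] then
     give the factor 4. *)
  have : 3 * 48 * (l1 (f p) t ^ 2)%:R <= (l1 u t ^ 2)%:R :> algR.
    rewrite -!natrM ler_nat -/D; have := fP p; move: rD; clear => a b.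
    apply: (@leq_trans (48 * r * (48 * r))); last by rewrite -mulnn leq_mul.
    rewrite -mulnn; nia.
  move=> k.
  have nn : 0 < n%:R ^+ 2 :> algR by rewrite exprn_gt0 ?ltr0n.
  rewrite -(ler_pM2l nn); lra.
(* [lrp u] vanishes at [u], so [u] must not be among the chosen vertices; it is not in
   [near_set u t] because [rho u t] is positive. *)
have far p : f p != u.
  apply: contraTneq (near p) => ->; rewrite inE -ltNge ltr_pMl ?rho_gt0 //; lra.
have term p : (lrsum u)^-1 / ((8 * D) ^ 2)%:R <= lrp u (f p).
  rewrite /lrp (negbTE (far p)) ler_wpM2l // lef_pV2 ?posrE ?ltr0n ?expn_gt0 ?muln_gt0 ?D0 //;
    last first.
    by rewrite (leq_trans (linf_gt0 _ _ _ _) (dist_ge _ _ _)) // eq_sym.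
  rewrite ler_nat leq_exp2r //; apply: leq_trans (dist_le _ _ _) _.
  rewrite (_ : 8 = 4 * 2)%N // -mulnA leq_mul2l /=.
  have := fP p; move: rD; rewrite /D /l1; clear; lia.
have nonneg v : 0 <= lrp u v by rewrite /lrp; case: ifP => // _; rewrite mulr_ge0 // invr_ge0 ler0n.
apply: (@le_trans _ _ (\sum_(v in [set f p | p in setT]) lrp u v)); last first.
  rewrite [leRHS](bigID (mem [set f p | p in setT])) /=.
  rewrite [X in _ <= X + _](eq_bigl (mem [set f p | p in setT])).
    by rewrite lerDl sumr_ge0.
  by move=> v; apply: andb_idl => /imsetP [p _ ->].
rewrite big_imset => [|p q _ _ /fi //].
apply: (@le_trans _ _ (\sum_(p in [set: 'I_r.+1 * 'I_r.+1])
    (lrsum u)^-1 / ((8 * D) ^ 2)%:R)); last first.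
  by apply: ler_sum.
rewrite sumr_const cardsT card_prod card_ord -[leRHS]mulr_natr -mulrA ler_wpM2l //.
have -> : ((8 * D) ^ 2)%:R^-1 * (r.+1 * r.+1)%:R = (r.+1%:R / (8 * D%:R)) ^+ 2 :> algR.
  by rewrite mulrC natrM -expr2 natrX natrM expr_div_n.
have x0 : 0 <= 384^-1 :> algR by rewrite invr_ge0.
have D0' : 0 < D%:R :> algR by rewrite ltr0n.
rewrite -exprVn ler_pXn2r ?nnegrE ?divr_ge0 ?mulr_ge0 ?(ltW D0') ?ler0n //.
rewrite ler_pdivlMr ?mulr_gt0 // mulrC ler_pdivrMr //.
move: Dr; rewrite -(ler_nat algR) natrM; lra.
Qed.

(** * Drift of a walk driven by independent choices *)

Section Drift.
Context {R : realFieldType} {T : finType}.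
Variable p : T -> T -> R.
Hypothesis p_ge0 : forall u v, 0 <= p u v.
Hypothesis p_sum1 : forall u, \sum_v p u v = 1.

Definition prodmeas (L : {ffun T -> T}) : R := \prod_u p u (L u).

Definition upd (L : {ffun T -> T}) (u v : T) : {ffun T -> T} :=
  [ffun x => if x == u then v else L x].

Lemma updxx L u v : upd L u v u = v.
Proof. by rewrite ffunE eqxx. Qed.

Lemma upd_upd L u v : upd (upd L u v) u (L u) = L.
Proof. by apply/ffunP => x; rewrite !ffunE; case: eqP => // ->. Qed.

Lemma prodmeas_ge0 L : 0 <= prodmeas L.
Proof. by apply: prodr_ge0. Qed.

Lemma prodmeas_sum1 : \sum_L prodmeas L = 1.
Proof. by rewrite -bigA_distr_bigA /= big1. Qed.

Lemma prodmeas_upd L u v : p u v * prodmeas L = p u (L u) * prodmeas (upd L u v).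
Proof.
rewrite /prodmeas (bigD1 u) //= [in RHS](bigD1 u) //= updxx mulrCA.
by congr (_ * (_ * _)); apply: eq_bigr => x xu; rewrite ffunE (negbTE xu).
Qed.

(* Exchanging the [u]-coordinate of [L] with a fresh sample [v] is an involution
   preserving the product of the two laws. *)
Lemma prodmeas_indep u (F : {ffun T -> T} -> R) (g : T -> R) :
  (forall L v, F (upd L u v) = F L) ->
  \sum_L prodmeas L * F L * g (L u) =
  (\sum_L prodmeas L * F L) * \sum_v p u v * g v.
Proof.
move=> Fu; rewrite big_distrlr /= pair_bigA /=.
transitivity (\sum_L \sum_v p u v * (prodmeas L * F L * g (L u))).
  by apply: eq_bigr => L _; rewrite -mulr_suml p_sum1 mul1r.
rewrite pair_bigA /=.
pose sw (x : {ffun T -> T} * T) := (upd x.1 u x.2, x.1 u).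
have swK : involutive sw by move=> [L v]; rewrite /sw /= upd_upd updxx.
rewrite (reindex_inj (inv_inj swK)); apply: eq_bigr => -[L v] _ /=.
by rewrite Fu updxx !mulrA -prodmeas_upd; congr (_ * _); rewrite -mulrA mulrC.
Qed.

(** Abstract greedy routing: [h u x] is the position after [u] when the contact of [u] is [x], and
    [psi] will be the cosine with the target. *)
Variables (h : T -> T -> T) (t : T) (psi : T -> R).
Hypothesis h_t : forall x, h t x = t.
Hypothesis h_psi : forall u x, u != t -> psi u < psi (h u x).

Definition walk (L : {ffun T -> T}) (s : T) (k : nat) : T :=
  iter k (fun u => h u (L u)) s.

Arguments walk : simpl never.

Lemma walkS L s k : walk L s k.+1 = h (walk L s k) (L (walk L s k)).
Proof. by []. Qed.

Lemma walk_psi L s j k : (j <= k)%N -> psi (walk L s j) <= psi (walk L s k).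
Proof.
elim: k => [|k IH]; first by rewrite leqn0 => /eqP ->.
rewrite leq_eqVlt => /orP [/eqP -> //|/IH/le_trans]; apply.
rewrite walkS; have [->|/h_psi/ltW //] := eqVneq (walk L s k) t.
by rewrite h_t.
Qed.

Lemma walk_t L s j k : (j <= k)%N -> walk L s j = t -> walk L s k = t.
Proof.
elim: k => [|k IH]; first by rewrite leqn0 => /eqP ->.
rewrite leq_eqVlt => /orP [/eqP -> //|/IH {}IH /IH].
by rewrite walkS => ->.
Qed.

Lemma walk_fresh L s j k : (j < k)%N -> walk L s k != t ->
  walk L s j != walk L s k.
Proof.
move=> jk kt.
have jt : walk L s j != t by apply: contra kt => /eqP /(walk_t _ _ _ _ (ltnW jk)) ->.
have := lt_le_trans (h_psi _ (L (walk L s j)) jt) (walk_psi L s _ _ jk).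
by move=> lt; apply: contraTneq lt => ->; rewrite ltxx.
Qed.

(** Otherwise the first [#|T|.+1] positions would be pairwise distinct. *)
Lemma walk_reaches L s : exists k, walk L s k = t.
Proof.
have [/existsP [k /eqP e]|/existsPn nt] :=
  boolP [exists k : 'I_#|T|.+1, walk L s k == t]; first by exists k.
have inj : injective (fun k : 'I_#|T|.+1 => walk L s k).
  move=> j k e; apply: val_inj; apply/eqP; rewrite eqn_leq.
  apply/andP; split; rewrite leqNgt; apply/negP => lt.
    by have := walk_fresh L s _ _ lt (nt j); rewrite e eqxx.
  by have := walk_fresh L s _ _ lt (nt k); rewrite e eqxx.
by have := leq_card _ inj; rewrite card_ord ltnn.
Qed.

(** A walk standing at [u] has not left [u] before, so being at [u] at time [k] is an event
    independent of the contact of [u]. *)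
Lemma walk_upd L s k u v : u != t -> (walk (upd L u v) s k == u) = (walk L s k == u).
Proof.
move=> ut.
have H L' v' : walk L' s k = u -> walk (upd L' u v') s k = u.
  move=> e; suff : forall j, (j <= k)%N -> walk (upd L' u v') s j = walk L' s j.
    by move/(_ k (leqnn k)) ->.
  elim=> [//|j IH] jk; rewrite !walkS (IH (ltnW jk)).
  rewrite ffunE -e (negbTE (walk_fresh _ _ _ _ jk _)) ?e //.
by apply/eqP/eqP => [/(H _ (L u))|/H->//]; rewrite upd_upd.
Qed.

Variables (lev : T -> nat) (good : T -> T -> bool) (q : R).
Hypothesis lev_le : forall u x, (lev (h u x) <= lev u)%N.
Hypothesis lev_lt : forall u x, u != t -> good u x -> (lev (h u x) < lev u)%N.
Hypothesis good_ge : forall u, u != t -> q <= \sum_(x | good u x) p u x.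

(** Split by the current position [u]: being there is independent of [L u], which is good with
    probability at least [q] and then lowers the level by at least 1; otherwise the level does not
    rise. *)
Lemma drift_step s k :
  q * (\sum_L prodmeas L * (walk L s k != t)%:R) <=
  \sum_L prodmeas L * ((lev (walk L s k))%:R - (lev (walk L s k.+1))%:R).
Proof.
have E L : (walk L s k != t)%:R = \sum_(u | u != t) (walk L s k == u)%:R :> R.
  have [->|nt] := eqVneq (walk L s k) t.
    by rewrite big1 // => u; rewrite eq_sym => /negbTE ->.
  rewrite (bigD1 (walk L s k)) //= eqxx big1 ?addr0 // => u /andP [_].
  by rewrite eq_sym => /negbTE ->.
under eq_bigr do rewrite E mulr_sumr.
rewrite exchange_big /= mulr_sumr.
apply: (@le_trans _ _ (\sum_(u | u != t) \sum_L
          prodmeas L * (walk L s k == u)%:R * (good u (L u))%:R)).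
  apply: ler_sum => u ut.
  rewrite (prodmeas_indep u (fun L => (walk L s k == u)%:R) (fun x => (good u x)%:R));
    last by move=> L v; rewrite walk_upd.
  rewrite mulrC ler_wpM2l //.
    by apply: sumr_ge0 => L _; rewrite mulr_ge0 ?prodmeas_ge0 ?ler0n.
  apply: le_trans (good_ge _ ut) _; rewrite big_mkcond /=.
  by apply: ler_sum => x _; case: ifP => _; rewrite ?mulr1 ?mulr0.
rewrite exchange_big /=; apply: ler_sum => L _.
under eq_bigr do rewrite -mulrA.
rewrite -mulr_sumr ler_wpM2l ?prodmeas_ge0 //.
rewrite lerBrDr walkS.
have [e|nt] := eqVneq (walk L s k) t.
  rewrite e big1 => [|u /negbTE]; last by rewrite eq_sym => ->; rewrite mul0r.
  by rewrite add0r ler_nat lev_le.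
rewrite (bigD1 (walk L s k)) //= eqxx mul1r big1 ?addr0 => [|u /andP [_]]; last first.
  by rewrite eq_sym => /negbTE ->; rewrite mul0r.
rewrite -natrD ler_nat.
by case: (boolP (good _ _)) => [/lev_lt|_]; [apply | exact: lev_le].
Qed.

(** Summed over [k], the expected decreases telescope to at most the initial level. *)
Lemma drift_bound s N :
  q * (\sum_L prodmeas L * (\sum_(k < N) (walk L s k != t))%:R) <= (lev s)%:R.
Proof.
under eq_bigr do rewrite natr_sum mulr_sumr.
rewrite exchange_big mulr_sumr /=.
apply: le_trans; first by apply: ler_sum => k _; exact: drift_step.
have -> : (lev s)%:R = \sum_L prodmeas L * (lev s)%:R by rewrite -mulr_suml prodmeas_sum1 mul1r.
rewrite exchange_big /=.
apply: ler_sum => L _; rewrite -mulr_sumr ler_wpM2l ?prodmeas_ge0 //.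
have -> : \sum_(k < N) ((lev (walk L s k))%:R - (lev (walk L s k.+1))%:R) =
    (lev s)%:R - (lev (walk L s N))%:R :> R.
  elim: N => [|M IH]; first by rewrite big_ord0 subrr.
  by rewrite big_ord_recr /= IH addrA subrK.
by rewrite gerBl ler0n.
Qed.

End Drift.

(** * The routing walk *)

Lemma lrsum_gt0 n (u : V n) : (0 < n)%N -> 0 < lrsum u.
Proof.
move=> n0.
have [w wu] : exists w : V n, w != u.
  apply/existsP; rewrite -[X in is_true X]negbK negb_exists; apply/negP => /forallP h.
  have : (#|V n| <= #|[set u]|)%N.
    apply: subset_leq_card; apply/fintype.subsetP => w _.
    by rewrite inE; have := h w; rewrite negbK.
  by have := card_V_ge _ u; rewrite cards1; lia.
rewrite /lrsum (bigD1 w) //= ltr_pwDl ?sumr_ge0 //.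
  rewrite invr_gt0 ltr0n expn_gt0 (leq_trans (linf_gt0 _ _ _ _) (dist_ge _ _ _)) //.
  by rewrite eq_sym.
by move=> v _; rewrite invr_ge0 ler0n.
Qed.

Lemma lrp_ge0 n (u v : V n) : (0 < n)%N -> 0 <= lrp u v.
Proof.
move=> n0; rewrite /lrp; case: ifP => // _.
by rewrite mulr_ge0 ?invr_ge0 ?ler0n // ltW // lrsum_gt0.
Qed.

Lemma lrp_sum1 n (u : V n) : (0 < n)%N -> \sum_v lrp u v = 1.
Proof.
move=> n0; rewrite (bigD1 u) //= {1}/lrp eqxx add0r.
under eq_bigr => v /negbTE vu do rewrite /lrp vu.
by rewrite -mulr_sumr mulVf // gt_eqF // lrsum_gt0.
Qed.

Lemma lrprobE n (u v : V n) : lrprob u v = algRval (lrp u v).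
Proof.
rewrite /lrprob /lrp; case: ifP => // _.
rewrite (rmorphM algRval) !(fmorphV algRval) (rmorph_nat algRval) /Zc /lrsum.
rewrite (rmorph_sum algRval); congr (_^-1 / _).
by apply: eq_bigr => w _; rewrite (fmorphV algRval) (rmorph_nat algRval).
Qed.

Lemma cfgprobE n (L : {ffun V n -> V n}) : cfgprob L = algRval (prodmeas lrp L).
Proof.
by rewrite /cfgprob /prodmeas (rmorph_prod algRval); apply: eq_bigr => u _; exact: lrprobE.
Qed.

(** * One routing step as a function of the contact *)

Definition cands {n : nat} (u x : V n) : {set V n} := x |: [set w | adj u w].

(** With [x := L u] this unfolds to [gstep]; taking the contact as an argument gives the shape
    required of [h] in the drift argument. *)
Definition hop {n : nat} (tb : V n -> {set V n} -> V n) (t u x : V n) : V n :=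
  if u == t then t
  else tb u [set v in cands u x | [forall w in cands u x, cosang w t <= cosang v t]].

Section Hop.
Variables (n : nat) (n0 : (0 < n)%N) (tb : V n -> {set V n} -> V n) (t : V n).
Hypothesis tbP : tiebreak tb.

Lemma hop_target x : hop tb t t x = t.
Proof. by rewrite /hop eqxx. Qed.

Lemma hop_best u x w : u != t -> w \in cands u x -> cosV w t <= cosV (hop tb t u x) t.
Proof.
move=> ut wc; rewrite /hop (negbTE ut).
set A := [set v in _ | _].
have A0 : A != set0.
  case: (arg_maxP (fun v => cosV v t) wc) => v vc vmax.
  apply/set0Pn; exists v; rewrite inE.
  apply/andP; split; [exact: vc | apply/forall_inP => v' vc'].
  by rewrite !cosangE //; exact: vmax.
have := tbP u A A0; rewrite inE => /andP [_ /forall_inP /(_ w wc)].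
by rewrite !cosangE.
Qed.

Lemma hop_closer u x : u != t -> cosV u t < cosV (hop tb t u x) t.
Proof.
move=> ut; have [w [uw lt]] := progress _ _ _ n0 ut.
by apply: lt_le_trans lt (hop_best _ _ _ ut _); rewrite !inE uw orbT.
Qed.

End Hop.

(** * Phases, counted by powers of 4 *)

Definition pow4_count (M : nat) (y : algR) : nat := (\sum_(i < M) (4 ^+ i <= y)%R)%N.

Lemma pow4_count_le M y : (pow4_count M y <= M)%N.
Proof.
rewrite -[leqRHS]card_ord -sum1_card; apply: leq_sum => i _; exact: leq_b1.
Qed.

Lemma pow4_count_mono M y y' : y <= y' -> (pow4_count M y <= pow4_count M y')%N.
Proof.
move=> yy; apply: leq_sum => i _.
by case: (boolP (4 ^+ i <= y)) => // /le_trans ->.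
Qed.

(** Each [4 ^ i <= y'] gives [4 ^ i.+1 <= y], and [4 ^ 0 <= y] is one more power; [y < 4 ^ M]
    prevents truncation at the top. *)
Lemma pow4_count_lt M y y' : 1 <= y -> y < 4 ^+ M -> 4 * y' <= y ->
  (pow4_count M y' < pow4_count M y)%N.
Proof.
case: M => [|M] y1 yM yy; first by move: yM; rewrite expr0 ltNge y1.
rewrite /pow4_count big_ord_recr [in ltnRHS]big_ord_recl /= expr0 y1.
rewrite leNgt (_ : y' < _) ?addn0 ?add1n ?ltnS.
  apply: leq_sum => i _; rewrite /bump /= add1n exprS.
  case: (boolP (4 ^+ i <= y')) => // h.
  by rewrite (le_trans _ yy) // ler_pM2l.
move: yM; rewrite exprS => yM; have := le_lt_trans yy yM.
by rewrite ltr_pM2l.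
Qed.

(** The factor [24 * n ^ 2] comes from [rho_lower] and makes the argument at least 1 for [u != t];
    the number of powers is large enough by [phase_top]. *)
Definition phase {n : nat} (t u : V n) : nat :=
  pow4_count (trunc_log 2 n).+4.+1 (24 * n%:R ^+ 2 * rho u t).

(** Since [l1 u t <= 2 * n], the left side is at most [36 * 4 * n ^ 2 = 144 * n ^ 2], and
    [144 < 4 ^ 4]. *)
Lemma phase_top n (t u : V n) : (0 < n)%N ->
  24 * n%:R ^+ 2 * rho u t < 4 ^+ (trunc_log 2 n).+4.+1.
Proof.
move=> n0; have up := rho_upper _ n0 u t.
have l : (l1 u t ^ 2)%:R <= 4 * n%:R ^+ 2 :> algR.
  rewrite -natrX -natrM ler_nat -[4%N]/(2 ^ 2)%N -expnMn leq_exp2r //.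
  by have := V_norm _ t; have := V_norm _ u; rewrite /l1; clear; lia.
have b : n%:R ^+ 2 < 4 ^+ (trunc_log 2 n).+1 :> algR.
  rewrite -!natrX ltr_nat -[4%N]/(2 ^ 2)%N expnAC ltn_exp2r //.
  exact: trunc_log_ltn.
have nn : 0 < n%:R ^+ 2 :> algR by rewrite exprn_gt0 ?ltr0n.
rewrite [ltRHS](_ : _ = 256 * 4 ^+ (trunc_log 2 n).+1); first lra.
by rewrite !exprS; ring.
Qed.

Lemma expected_boundR n (s t : V n) tb : (2 <= n)%N -> tiebreak tb ->
  \sum_L prodmeas lrp L *
    (\sum_(k < #|V n|) (walk (hop tb t) L s k != t))%:R <=
  1296 * 384 ^+ 2 * ((trunc_log 2 n) ^ 2)%:R :> algR.
Proof.
move=> n2 tbP; have n0 : (0 < n)%N by exact: ltnW.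
set l := trunc_log 2 n.
have l0 : (0 < l)%N by rewrite /l trunc_log_gt0.
(* The lower bound of [lrp_near_ge] after inserting [lrsum_le]. *)
pose q : algR := (72 * l.+2%:R * 384 ^+ 2)^-1.
have q0 : 0 < q.
  by rewrite invr_gt0 mulr_gt0 ?exprn_gt0 // mulr_gt0 // ltr0n.
have := @drift_bound algR (V n) lrp (fun u v => lrp_ge0 _ u v n0)
  (fun u => lrp_sum1 _ u n0) (hop tb t) t (fun u => cosV u t)
  (hop_target _ tb t) (fun u x => hop_closer _ n0 tb t tbP u x) (phase t)
  (fun u x => 4 * rho x t <= rho u t) q _ _ _ s #|V n|.
have nn : 0 < 24 * n%:R ^+ 2 :> algR by rewrite mulr_gt0 // exprn_gt0 ?ltr0n.
have mono (u x : V n) : (phase t (hop tb t u x) <= phase t u)%N.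
  have [->|ut] := eqVneq u t; first by rewrite hop_target.
  apply: pow4_count_mono; rewrite ler_pM2l // /rho lerD2l lerN2 ltW //.
  exact: hop_closer.
have drop (u x : V n) : u != t -> 4 * rho x t <= rho u t ->
    (phase t (hop tb t u x) < phase t u)%N.
  move=> ut ux; apply: pow4_count_lt; last 1 first.
  - rewrite mulrCA ler_pM2l //; apply: le_trans ux; rewrite ler_pM2l //.
    by rewrite /rho lerD2l lerN2; apply: hop_best; rewrite // !inE eqxx.
  - apply: le_trans (rho_lower _ n0 u t); rewrite ler1n expn_gt0.
    by have := linf_gt0 _ _ _ ut; rewrite /linf !leq_max /l1; clear; lia.
  - exact: phase_top.
have hit (u : V n) : u != t -> q <= \sum_(x | 4 * rho x t <= rho u t) lrp u x.
  move=> ut; have := lrp_near_ge _ _ _ n0 ut.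
  rewrite /near_set (eq_bigl (fun x => 4 * rho x t <= rho u t)); last by move=> x; rewrite inE.
  apply: le_trans; rewrite /q invfM ler_pM2r ?invr_gt0 ?exprn_gt0 //.
  by rewrite lef_pV2 ?posrE ?lrsum_gt0 ?mulr_gt0 ?ltr0n // lrsum_le.
move=> /(_ mono drop hit) bound.
have lev : (phase t s <= l.+4.+1)%N by exact: pow4_count_le.
set E := \sum_L _ in bound *.
have : E <= (phase t s)%:R / q by rewrite ler_pdivlMr // mulrC.
move=> /le_trans; apply; rewrite /q invrK.
(* As [l >= 1], [l + 5 <= 6 * l] and [l + 2 <= 3 * l]; the constant is [6 * 72 * 3 = 1296]. *)
apply: (@le_trans _ _ ((6 * l)%:R * (72 * (3 * l)%:R * 384 ^+ 2))).
  rewrite ler_pM ?ler0n ?mulr_ge0 ?exprn_ge0 ?ler0n //.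
    by rewrite ler_nat (leq_trans lev) //; clear -l0; lia.
  rewrite ler_pM2r ?exprn_gt0 // ler_pM2l // ler_nat; clear -l0; lia.
by rewrite natrX !natrM le_eqVlt; apply/orP; left; apply/eqP; ring.
Qed.

Theorem theorem2 :
  exists c : algC, 0 < c /\
    forall (n : nat), (2 <= n)%N ->
    forall (s t : V n) (tb : V n -> {set V n} -> V n), tiebreak tb ->
      (forall L : {ffun V n -> V n}, cfgprob L != 0 -> reaches tb L s t) /\
      expected_forwards tb s t <= c * ((trunc_log 2 n) ^ 2)%:R.
Proof.
exists (algRval (1296 * 384 ^+ 2)); split.
  by rewrite -[_ < _]/((0 : algR) < _) mulr_gt0 ?exprn_gt0.
move=> n n2 s t tb tbP; have n0 : (0 < n)%N by exact: ltnW.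
split=> [L _|].
  have [k e] := walk_reaches (hop tb t) t (fun u => cosV u t) (hop_target _ tb t)
    (fun u x => hop_closer _ n0 tb t tbP u x) L s.
  by exists k.
have -> : expected_forwards tb s t = algRval (\sum_L prodmeas lrp L *
    (\sum_(k < #|V n|) (walk (hop tb t) L s k != t))%:R).
  rewrite /expected_forwards (rmorph_sum algRval); apply: eq_bigr => L _.
  by rewrite cfgprobE (rmorphM algRval) (rmorph_nat algRval).
rewrite -(rmorph_nat algRval) -(rmorphM algRval).
exact: expected_boundR.
Qed.
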